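(* Let $1\le p\le q<\infty$ and $Q\in(0,q)$. Assume that $(X,d,\mu)$ is a metric measure space, with doubling measure $\mu$, which supports a weak $(1,p)$-Poincaré inequality. If there exists a positive constant $C$ such that $\mu(B(x,r))\ge C r^Q$ for all $x\in X$ and $0<r<2\,\mathrm{diam}(X)$, then $$NM_p^q(X)\hookrightarrow C^{0,1-Q/q}(X).$$
   Context: Throughout, $(X,d,\mu)$ is a metric space with a non-trivial Borel regular measure $\mu$ which is finite on bounded sets and positive on (non-empty) open sets. $\mu$ is doubling if there is a constant $C>0$ with $\mu(2B)\le C\mu(B)$ for all balls $B$; $\tau B$ is the ball with the same center as $B$ and $\tau$ times its radius. Morrey space: for $1\le p\le q<\infty$, $\mathcal{M}_p^q(X)$ is the space of all measurable functions $f$ on $X$ with $$\|f\|_{\mathcal{M}_p^q(X)}:=\sup_{B\subset X}[\mu(B)]^{1/q-1/p}\left[\int_B|f(x)|^p\,d\mu(x)\right]^{1/p}<\infty,$$ the supremum being over all balls $B$ in $X$. Curves: a curve is a continuous mapping from an interval into $X$; it is rectifiable if its length is finite; rectifiable curves are always arc-length parameterized, and $l(\gamma)$ denotes the length of $\gamma$. For a family $\Gamma$ of rectifiable curves, $F(\Gamma)$ is the set of Borel measurable functions $\rho:X\to[0,\infty]$ with $\int_\gamma\rho\,ds\ge 1$ for all $\gamma\in\Gamma$ (so $F(\Gamma)=\emptyset$ if $\Gamma$ contains a constant curve). The Morrey-modulus is $\mathrm{Mod}_p^q(\Gamma):=\inf_{\rho\in F(\Gamma)}\|\rho\|_{\mathcal{M}_p^q(X)}^p$,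 with $\inf\emptyset=\infty$. A non-negative Borel function $g$ is an upper gradient of a measurable function $f$ if $$|f\circ\gamma(0)-f\circ\gamma(l(\gamma))|\le\int_\gamma g\,ds$$ for all non-constant rectifiable curves $\gamma$; it is a $\mathrm{Mod}_p^q$-weak upper gradient of $f$ if this inequality holds for all non-constant rectifiable curves except a family of Morrey-modulus zero. $\widetilde{NM_p^q}(X)$ is the set of measurable $f$ with $\|f\|_{\widetilde{NM_p^q}(X)}:=\|f\|_{\mathcal{M}_p^q(X)}+\inf\|g\|_{\mathcal{M}_p^q(X)}<\infty$, the infimum over all $\mathrm{Mod}_p^q$-weak upper gradients $g$ of $f$. The Newton-Morrey-Sobolev space $NM_p^q(X)$ is the quotient of $\widetilde{NM_p^q}(X)$ by $\{f:\|f\|_{\widetilde{NM_p^q}(X)}=0\}$, with the induced norm. $X$ supports a weak $(1,p)$-Poincaré inequality if there are constants $C>0$ and $\tau\ge1$ such that, for all open balls $B$ in $X$ and all functions $f,\rho$ on $\tau B$ with $\rho$ an upper gradient of $f$ in $\tau B$ and $f$ integrable on $B$, $$\frac1{\mu(B)}\int_B|f-f_B|\,d\mu\le C\,\mathrm{diam}(B)\left\{\frac1{\mu(\tau B)}\int_{\tau B}\rho^p\,d\mu\right\}^{1/p},\qquad f_B:=\frac1{\mu(B)}\int_Bf\,d\mu.$$ For $\alpha\in(0,1]$, $C^{0,\alpha}(X)$ is the space of functions $f$ for which there is a constant $K$ with $|f(x)-f(y)|\le K[d(x,y)]^\alpha$ for all $x,y\in X$. The symbol $\hookrightarrow$ means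 continuous embedding; here: there is a constant $C'>0$ such that every $f\in NM_p^q(X)$ has a representative satisfying $|f(x)-f(y)|\le C'\|f\|_{NM_p^q(X)}[d(x,y)]^{1-Q/q}$ for all $x,y\in X$. *)

(* Defs.v *)
From HB Require Import structures.
From mathcomp Require Import all_boot all_order all_algebra.
From mathcomp Require Import all_classical all_reals all_analysis.
From mathcomp Require Import measurable_realfun.

Set Implicit Arguments.
Unset Strict Implicit.
Unset Printing Implicit Defensive.

Import Order.TTheory GRing.Theory Num.Theory.
Import numFieldNormedType.Exports.

Local Open Scope classical_set_scope.
Local Open Scope ring_scope.

(* The measure theory of the library lives on pointed types; a space carrying
   a non-trivial measure is non-empty, so the base point costs no generality. *)
#[short(type="pmetricType")]
HB.structure Definition PMetric (K : numDomainType) :=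
  { M of Metric K M & isPointed M }.

Section metric_notions.
Context {R : realType} {X : pmetricType R}.
Implicit Types (A : set X) (c : R -> X).

Definition diam A : \bar R :=
  ereal_sup [set (mdist u.1 u.2)%:E | u in A `*` A].

(* Borel sets are the measurable sets of this type. *)
Definition borelType := g_sigma_algebraType (@open X).

Definition polygonal_length (a b : R) c (s : seq R) : R :=
  let F := c \o nth b (a :: s) in \sum_(0 <= i < size s) mdist (F i) (F i.+1).

Definition curve_length (a b : R) c : \bar R :=
  ereal_sup [set (polygonal_length a b c s)%:E | s in itv_partition a b].

(* A rectifiable curve, given by its arc-length parametrization on the interval
   [0, clength]; the values of cpath outside this interval are irrelevant. *)
Record curve := Curve {
  cpath :> R -> X ;
  clength : R ;
  clength_ge0 : 0 <= clength ;
  cpath_continuous : {within `[0, clength], continuous cpath} ;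
  cpath_arclength : forall t, t \in `[0, clength] ->
    curve_length 0 t cpath = t%:E }.

Definition curve_integral (g : curve) (rho : X -> \bar R) : \bar R :=
  (\int[lebesgue_measure]_(t in `[0%R, clength g]) rho (g t))%E.

Definition constant_curve (g : curve) : Prop := clength g = 0.

Definition admissible (Gamma : set curve) : set (X -> \bar R) :=
  [set rho | [/\ measurable_fun setT (rho : borelType -> \bar R),
                 forall x, (0 <= rho x)%E &
                 forall g, Gamma g -> (1 <= curve_integral g rho)%E]].

Definition upper_gradient_along (f : X -> R) (rho : X -> \bar R) (g : curve) :=
  (`|f (g 0) - f (g (clength g))|%:E <= curve_integral g rho)%E.

End metric_notions.

Arguments curve {R} X.
Arguments borelType {R} X.

Section metric_measure_space.
Context {R : realType} {X : pmetricType R}.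
(* As usual in this setting, a Borel regular measure is an outer measure on all
   subsets of X; measurability of sets and functions is meant in the sense of
   Caratheodory. *)
Variable mu : {outer_measure set X -> \bar R}.

Definition muType := caratheodory_type mu.

Definition measure_of : {measure set muType -> \bar R} :=
  (mu : set (caratheodory_type mu) -> \bar R).

Definition borel_regular :=
  (forall U : set X, open U -> mu.-cara.-measurable U) /\
  (forall A : set X, exists B : set X,
    [/\ (measurable : set (set (borelType X))) B, A `<=` B & mu B = mu A]).

Definition metric_measure_axioms :=
  [/\ borel_regular,
      exists A : set X, mu A != 0%E,
      forall A : set X, (diam A < +oo)%E -> (mu A < +oo)%E &
      forall U : set X, open U -> U !=set0 -> (0 < mu U)%E].

Definition doubling :=
  exists2 C : R, 0 < C &
    forall (x : X) (r : R), 0 < r ->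
      (mu (ball x (2 * r)) <= C%:E * mu (ball x r))%E.

Definition mean (A : set X) (h : X -> \bar R) : \bar R :=
  ((mu A)^-1 * \int[measure_of]_(y in A) h y)%E.

Definition upper_gradient_on (A : set X) (f : X -> R) (rho : X -> \bar R) :=
  [/\ measurable_fun (A : set muType) (f : muType -> R),
      measurable_fun (A : set (borelType X)) (rho : borelType X -> \bar R),
      forall x, A x -> (0 <= rho x)%E &
      forall g : curve X, ~ constant_curve g ->
        (forall t, t \in `[0, clength g] -> A (g t)) ->
        upper_gradient_along f rho g].

(* Functions on tau B are represented by total functions of which only the
   values on tau B are constrained. *)
Definition weak_poincare (p : R) :=
  exists C tau : R, [/\ 0 < C, 1 <= tau &
    forall (x : X) (r : R) (f : X -> R) (rho : X -> \bar R), 0 < r ->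
      upper_gradient_on (ball x (tau * r)) f rho ->
      measure_of.-integrable (ball x r : set muType) (EFin \o f) ->
      let fB := fine (mean (ball x r) (EFin \o f)) in
      (mean (ball x r) (fun y => `|f y - fB|%:E) <=
       C%:E * diam (ball x r) *
       (mean (ball x (tau * r)) (fun y => rho y `^ p)) `^ p^-1)%E].

Section Newton_Morrey_Sobolev.
Variables p q : R.

Definition morrey_norm (f : X -> \bar R) : \bar R :=
  ereal_sup [set ((mu (ball u.1 u.2)) `^ (q^-1 - p^-1)%R *
      (\int[measure_of]_(y in ball u.1 u.2) (`|f y| `^ p)) `^ p^-1)%E
    | u in [set u : X * R | 0 < u.2]].

Definition morrey_modulus (Gamma : set (curve X)) : \bar R :=
  ereal_inf [set ((morrey_norm rho) `^ p)%E | rho in admissible Gamma].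

Definition weak_upper_gradient (f : X -> R) (rho : X -> \bar R) :=
  [/\ measurable_fun setT (rho : borelType X -> \bar R),
      forall x, (0 <= rho x)%E &
      exists2 Gamma : set (curve X), morrey_modulus Gamma = 0%E &
        forall g : curve X, ~ constant_curve g -> ~ Gamma g ->
          upper_gradient_along f rho g].

Definition prenorm (f : X -> R) : \bar R :=
  (morrey_norm (EFin \o f) +
   ereal_inf [set morrey_norm rho | rho in weak_upper_gradient f])%E.

Definition NMtilde : set (X -> R) :=
  [set f | measurable_fun setT (f : muType -> R) /\ (prenorm f < +oo)%E].

Definition NMclass (f : X -> R) : set (X -> R) :=
  [set h | NMtilde h /\ prenorm (h \- f) = 0%E].

Definition NM : set (set (X -> R)) := [set NMclass f | f in NMtilde].

Definition NMnorm (F : set (X -> R)) : \bar R :=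
  ereal_inf [set prenorm f | f in F].

End Newton_Morrey_Sobolev.

End metric_measure_space.

(* Main.v *)
Require Import Defs.
From HB Require Import structures.
From mathcomp Require Import all_boot all_order all_algebra.
From mathcomp Require Import all_classical all_reals all_analysis.
From mathcomp Require Import measurable_realfun.
From mathcomp Require Import ring lra.
Set Implicit Arguments.
Unset Strict Implicit.
Unset Printing Implicit Defensive.
Import Order.TTheory GRing.Theory Num.Theory.
Import numFieldNormedType.Exports.
Local Open Scope classical_set_scope.
Local Open Scope ring_scope.

(** Every [f] in the space has a Borel upper gradient of finite Morrey norm
    [M].  The Morrey condition bounds the p-th mean of this gradient over a
    ball [B] by [M mu(B)^(-1/q)], which is at most a multiple of
    [M r^(-Q/q)] because [mu(B) >= C r^Q].  With the factor [diam B] of the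
    Poincare inequality, the mean oscillation of [f] over every ball of radius
    [r < 2 diam X] is therefore at most a multiple of [M r^(1 - Q/q)]
    ([poincare_oscillation]).  The exponent is positive, so by doubling the
    averages of [f] over shrinking concentric balls converge geometrically at
    every point, and the limits form a Hoelder continuous function
    ([averages_representative], [representative_hoelder]).  This is the
    Campanato argument; a Vitali-type covering shows that the limit function
    equals [f] almost everywhere ([representative_ae]).

    Two points need care.  The Poincare inequality concerns genuine upper
    gradients, while the norm is an infimum over weak ones.  A family of
    curves of modulus zero admits functions [rho_n] of arbitrarily small norm,
    and a weighted l^p sum of these and of a weak upper gradient has infinite
    integral along every exceptional curve, at an arbitrarily small
    cost in norm ([genuine_upper_gradient]).

    The continuous function must also lie in the class of [f], which is an
    equivalence for the Newton-Morrey norm and hence finer than almost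
    everywhere equality.  On a Borel null set containing the points where two
    functions differ, give the gradient the value infinity.  A curve with
    finite gradient integral then meets the null set in length zero, and along
    it the original function is continuous at both endpoints, because the
    inequality holds on all initial and terminal segments of the curve.  So
    the two functions agree at the endpoints of all curves outside a family of
    modulus zero, and [0] is a weak upper gradient of their difference
    ([endpoints_agree], [continuous_representative]).

    Finally, members of one class are equal almost everywhere, so they share
    one continuous representative, and the Hoelder bound obtained from each
    member and each weak upper gradient passes to the infimum. *)

(** * Balls and measurability *)

Section balls.
Context {R : realType} {X : pmetricType R}.
Implicit Types (x y z : X) (r s : R).

Lemma subset_ball x y r s : mdist x y + r <= s -> ball y r `<=` ball x s.
Proof.
rewrite !ballEmdist => h z /= yz; apply: le_lt_trans (metric_triangle x y z) _.
by apply: lt_le_trans h; rewrite ltrD2l.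
Qed.

Lemma metric_ball_open x r : open (ball x r).
Proof.
rewrite openE => y; rewrite ballEmdist /= => xy.
apply/nbhs_ballP; exists (r - mdist x y) => /=; first by rewrite subr_gt0.
by rewrite -ballEmdist; apply: subset_ball; rewrite addrC subrK.
Qed.

Lemma diam_ball_le x r : (diam (ball x r) <= (2 * r)%:E)%E.
Proof.
apply: ge_ereal_sup => _ [[y z] [/= yx zx] <-]; rewrite lee_fin.
rewrite ballEmdist /= in yx; rewrite ballEmdist /= in zx.
apply: le_trans (metric_triangle y x z) _; rewrite metric_sym mulr2n mulrDl mul1r.
by rewrite lerD // ltW.
Qed.

Lemma mdist_le_diam x y : ((mdist x y)%:E <= diam [set: X] :> \bar R)%E.
Proof. by apply: ereal_sup_ubound; exists (x, y). Qed.

End balls.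

Section measure_basics.
Context {R : realType} {X : pmetricType R}.
Variable mu : {outer_measure set X -> \bar R}.
Hypothesis mms : metric_measure_axioms mu.
Implicit Types (x y z : X) (r s : R).

Lemma open_caratheodory (U : set X) : open U -> mu.-cara.-measurable U.
Proof. by case: mms => -[h _] _ _ _; exact: h. Qed.

Lemma caratheodory_ball x r : mu.-cara.-measurable (ball x r).
Proof. exact/open_caratheodory/metric_ball_open. Qed.

(** The admissible functions and upper gradients are Borel, while integrals
    over balls are taken with respect to the Caratheodory measurable sets. *)
Lemma measurable_borel_caratheodory (A : set X) :
  (measurable : set (set (borelType X))) A -> mu.-cara.-measurable A.
Proof.
move: A; apply: smallest_sub; last by move=> A; exact: open_caratheodory.
split; first exact: measurable0.
- by move=> A mA; rewrite setTD; exact: measurableC.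
- by move=> F mF; exact: bigcup_measurable.
Qed.

Lemma measurable_fun_borel_caratheodory d (T : measurableType d) (f : X -> T) :
  measurable_fun [set: borelType X] (f : borelType X -> T) ->
  measurable_fun [set: muType mu] (f : muType mu -> T).
Proof.
by move=> mf _ A mA; apply: measurable_borel_caratheodory; exact: mf.
Qed.

Lemma measure_ball_lty x r : (mu (ball x r) < +oo)%E.
Proof.
case: mms => _ _ h _; apply: h; apply: le_lt_trans (diam_ball_le x r) _.
exact: ltry.
Qed.

Lemma measure_ball_gt0 x r : 0 < r -> (0 < mu (ball x r))%E.
Proof.
move=> r0; case: mms => _ _ _; apply; first exact: metric_ball_open.
by exists x; exact: ballxx.
Qed.

Lemma measure_ball_fin x r : mu (ball x r) \is a fin_num.
Proof. by rewrite ge0_fin_numE ?outer_measure_ge0// measure_ball_lty. Qed.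

Lemma fine_measure_ball_gt0 x r : 0 < r -> 0 < fine (mu (ball x r)).
Proof. by move=> r0; rewrite fine_gt0// measure_ball_gt0//= measure_ball_lty. Qed.

Lemma le_measure_ball x y r s : ball x r `<=` ball y s ->
  fine (mu (ball x r)) <= fine (mu (ball y s)).
Proof.
by move=> h; rewrite fine_le ?measure_ball_fin//; exact: le_outer_measure.
Qed.

Lemma doubling_iter (C : R) k x r : 0 < r -> 0 < C ->
  (forall x r, 0 < r -> (mu (ball x (2 * r)) <= C%:E * mu (ball x r))%E) ->
  fine (mu (ball x (2 ^+ k * r))) <= C ^+ k * fine (mu (ball x r)).
Proof.
move=> r0 C0 dbl; elim: k => [|k IH]; first by rewrite !expr0 !mul1r.
rewrite !exprS -!mulrA; apply: (@le_trans _ _ (C * fine (mu (ball x (2 ^+ k * r))))).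
  have := dbl x (2 ^+ k * r) ltac:(by rewrite mulr_gt0 ?exprn_gt0).
  rewrite -(fineK (measure_ball_fin _ (2 ^+ k * r))) -EFinM.
  by rewrite -(fineK (measure_ball_fin _ (2 * _))) lee_fin.
by rewrite ler_wpM2l // ltW.
Qed.

End measure_basics.

(** * Integrals along curves *)

Section curve_integrals.
Context {R : realType} {X : pmetricType R}.
Implicit Types (g : curve X) (rho : X -> \bar R).

Lemma measurable_curve g :
  measurable_fun (`[0, clength g] : set R) (g : R -> borelType X).
Proof.
apply: (measurability (@open X : set (set (borelType X)))) => //.
move=> _ [U oU <-]; apply: open_measurable_subspace => //.
by have /continuousP := @cpath_continuous _ _ g; apply.
Qed.

Lemma measurable_along_curve g rho
    (mrho : measurable_fun setT (rho : borelType X -> \bar R)) :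
  measurable_fun (`[0, clength g] : set R) (rho \o g).
Proof. by apply: measurableT_comp mrho _; exact: measurable_curve. Qed.

Lemma le_curve_integral g rho1 rho2 :
  measurable_fun setT (rho1 : borelType X -> \bar R) ->
  measurable_fun setT (rho2 : borelType X -> \bar R) ->
  (forall x, 0 <= rho1 x)%E -> (forall x, rho1 x <= rho2 x)%E ->
  (curve_integral g rho1 <= curve_integral g rho2)%E.
Proof.
move=> m1 m2 p1 p12; apply: ge0_le_integral => //.
- exact: (measurable_along_curve m1).
- exact: (measurable_along_curve m2).
Qed.

Lemma curve_integralZ g rho (k : R) :
  measurable_fun setT (rho : borelType X -> \bar R) ->
  (forall x, 0 <= rho x)%E -> 0 <= k ->
  curve_integral g (fun x => k%:E * rho x)%E = (k%:E * curve_integral g rho)%E.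
Proof.
move=> m p k0; apply: ge0_integralZl_EFin => //.
exact: (measurable_along_curve m).
Qed.

Lemma curve_integral_ge0 g rho : (forall x, 0 <= rho x)%E ->
  (0 <= curve_integral g rho)%E.
Proof. by move=> h; apply: integral_ge0 => *. Qed.

End curve_integrals.

(** * Morrey norms and genuine upper gradients *)

Lemma powR_scaled_le {R : realType} (p m i M a : R) : 0 < p -> 0 < m -> 0 <= i -> 0 <= M ->
  (m `^ (- a) * i `^ p^-1 <= M) = (i <= M `^ p * m `^ (a * p)).
Proof.
move=> p0 m0 i0 M0; rewrite powRN mulrC ler_pdivrMr ?powR_gt0//.
have -> : M `^ p * m `^ (a * p) = (M * m `^ a) `^ p.
  by rewrite powRM ?powR_ge0// powRrM.
have Mm0 : 0 <= M * m `^ a by rewrite mulr_ge0 ?powR_ge0.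
apply/idP/idP => h.
  have := ge0_ler_powR (ltW p0) _ _ h; rewrite !nnegrE powR_ge0 => /(_ isT Mm0).
  by rewrite -powRrM mulVf ?gt_eqF// powRr1.
have p1 : 0 <= p^-1 by rewrite invr_ge0 ltW.
have := ge0_ler_powR p1 _ _ h; rewrite !nnegrE i0 powR_ge0 => /(_ isT isT).
by rewrite -powRrM mulfV ?gt_eqF// powRr1.
Qed.

Section morrey.
Context {R : realType} {X : pmetricType R}.
Variable mu : {outer_measure set X -> \bar R}.
Hypothesis mms : metric_measure_axioms mu.
Variables p q : R.
Hypothesis p_gt0 : 0 < p.
Implicit Types (x y z : X) (r s M : R).

(** The condition of Morrey norm at most [M], with all roots removed: in this
    form it is additive in the p-th power of the function, and Minkowski's
    inequality is never needed. *)
Definition morrey_bound (G : X -> \bar R) M := forall x r, 0 < r ->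
  (\int[measure_of mu]_(y in ball x r) (`|G y| `^ p) <=
   (M `^ p * fine (mu (ball x r)) `^ (1 - p / q))%:E)%E.

Lemma morrey_normP (G : X -> \bar R) M : 0 <= M ->
  (morrey_norm mu p q G <= M%:E)%E <-> morrey_bound G M.
Proof.
move=> M0.
have key x r : 0 < r ->
  ((mu (ball x r)) `^ (q^-1 - p^-1)%R *
      (\int[measure_of mu]_(y in ball x r) (`|G y| `^ p)) `^ p^-1 <= M%:E)%E =
  (\int[measure_of mu]_(y in ball x r) (`|G y| `^ p) <=
   (M `^ p * fine (mu (ball x r)) `^ (1 - p / q))%:E)%E.
  move=> r0; rewrite -(fineK (measure_ball_fin mms x r)).
  have m0 := fine_measure_ball_gt0 mms x r0.
  rewrite poweR_EFin.
  have: (0 <= \int[measure_of mu]_(y in ball x r) (`|G y| `^ p))%E.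
    by apply: integral_ge0 => y _; exact: poweR_ge0.
  case: (integral _ _ _) => [i|_|//].
    rewrite lee_fin => i0; rewrite poweR_EFin -EFinM !lee_fin.
    rewrite -opprB powR_scaled_le// mulrBl mulVf ?gt_eqF//.
    by rewrite [p / q]mulrC.
  by rewrite poweRyr ?invr_eq0 ?gt_eqF// gt0_muley ?lte_fin ?powR_gt0.
split=> [h x r r0|h].
  rewrite -key//; apply: le_trans h; apply: ereal_sup_ubound.
  by exists (x, r).
by apply: ge_ereal_sup => _ [[x r] /= r0 <-]; rewrite key// h.
Qed.

Lemma morrey_norm_ge0 G : (0 <= morrey_norm mu p q G)%E.
Proof.
apply: le_trans (ereal_sup_ubound _); last by exists (point, 1) => //=.
by rewrite mule_ge0 ?poweR_ge0.
Qed.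

Lemma morrey_boundZ G M (k : R) : 0 <= k -> 0 <= M ->
  measurable_fun [set: muType mu] (G : muType mu -> \bar R) ->
  morrey_bound G M -> morrey_bound (fun y => k%:E * G y)%E (k * M).
Proof.
move=> k0 M0 mG h x r r0.
under eq_integral do rewrite abseM gee0_abs ?lee_fin// poweRM ?lee_fin// poweR_EFin.
rewrite ge0_integralZl_EFin ?powR_ge0//.
- rewrite powRM// -mulrA EFinM lee_wpmul2l ?lee_fin ?powR_ge0//; exact: h.
- exact: (caratheodory_ball mms).
- by move=> y _; exact: poweR_ge0.
- apply: measurable_funTS; apply: (measurableT_comp (measurable_poweR _)).
  exact: measurableT_comp.
Qed.

Lemma modulus0_admissible Gamma e : morrey_modulus mu p q Gamma = 0%E -> 0 < e ->
  exists2 rho, admissible Gamma rho & morrey_bound rho e.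
Proof.
move=> h e0.
have : (morrey_modulus mu p q Gamma < (e `^ p)%:E)%E by rewrite h lte_fin powR_gt0.
move=> /ereal_inf_lt[_ [rho arho <-] lt_rho]; exists rho => //.
apply/morrey_normP; first exact: ltW.
have p1 : 0 <= p^-1 by rewrite invr_ge0 ltW.
have := gt0_ler_poweR p1 _ _ (ltW lt_rho).
rewrite !in_itv /= !leey !andbT poweR_ge0 lee_fin powR_ge0 => /(_ isT isT).
rewrite -poweRrM mulfV ?gt_eqF// poweRe1 ?morrey_norm_ge0//.
by rewrite ?poweR_EFin -powRrM mulfV ?gt_eqF// powRr1// ltW.
Qed.

(** Functions [rho_n] admissible for the exceptional family exist with
    arbitrarily small norm.  The p-th power of [G] is the sum of the p-th
    powers of [g] and of all [(n + 1) rho_n]: then [G] dominates [g], which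
    settles the other curves, and dominates [(n + 1) rho_n] for every [n],
    which makes the integral of [G] infinite along an exceptional curve.  The
    bounds on the p-th powers add up to a total increase that fits in the gap
    between the norm of [g] and [M]. *)
Lemma genuine_upper_gradient f g M : weak_upper_gradient mu p q f g ->
  (morrey_norm mu p q g < M%:E)%E ->
  exists G : X -> \bar R,
  [/\ measurable_fun setT (G : borelType X -> \bar R), forall x, (0 <= G x)%E,
      morrey_bound G M &
      forall c : curve X, ~ constant_curve c -> upper_gradient_along f G c].
Proof.
move=> [mg g0 [Gamma Gamma0 ugf]] gM.
have gfin : morrey_norm mu p q g \is a fin_num.
  by rewrite ge0_fin_numE ?morrey_norm_ge0// (lt_trans gM)// ltry.
set M1 := fine (morrey_norm mu p q g).
have M1_ge0 : 0 <= M1 by rewrite fine_ge0 ?morrey_norm_ge0.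
have M1M : M1 < M by rewrite -lte_fin fineK.
have bg : morrey_bound g M1 by apply/morrey_normP => //; rewrite fineK.
pose d := M `^ p - M1 `^ p.
have d0 : 0 < d.
  rewrite subr_gt0; apply: gt0_ltr_powR => //; rewrite nnegrE//.
  exact: le_trans (ltW M1M).
(* the p-th powers of the tolerances add up to the gap [d] *)
pose e n := (d / (2 ^ n.+1)%:R) `^ p^-1.
have dn0 n : 0 < d / (2 ^ n.+1)%:R by rewrite divr_gt0// ltr0n expn_gt0.
have e0 n : 0 < e n by rewrite powR_gt0.
have eE n : e n `^ p = d / (2 ^ n.+1)%:R.
  by rewrite -powRrM mulVf ?gt_eqF// powRr1// ltW.
have /choice[rho rhoP] n : exists rho : X -> \bar R, admissible Gamma rho /\
    morrey_bound (fun y => n.+1%:R%:E * rho y)%E (e n).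
  have en0 : 0 < e n / n.+1%:R by rewrite divr_gt0// ltr0n.
  have [rho arho brho] := modulus0_admissible Gamma0 en0.
  exists rho; split => //; have [mrho _ _] := arho.
  rewrite -[e n](@divfK _ n.+1%:R) ?pnatr_eq0// mulrC.
  apply: morrey_boundZ => //; first exact: ltW.
  exact: measurable_fun_borel_caratheodory.
pose r n y := (n.+1%:R%:E * rho n y)%E.
have r0 n y : (0 <= r n y)%E.
  by rewrite mule_ge0//; have [[_ ? _] _] := rhoP n.
have mr n : measurable_fun setT (r n : borelType X -> \bar R).
  by apply: measurable_funeM; have [[]] := rhoP n.
pose S y := (\sum_(n <oo) (r n y) `^ p)%E.
have S0 y : (0 <= S y)%E by apply: nneseries_ge0 => n _ _; exact: poweR_ge0.
have mrp n : measurable_fun setT (fun y : borelType X => (r n y) `^ p)%E.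
  exact: (measurableT_comp (measurable_poweR p)).
have mS : measurable_fun setT (S : borelType X -> \bar R).
  by apply: ge0_emeasurable_sum => // n y *; exact: poweR_ge0.
pose G y := ((g y `^ p + S y) `^ p^-1)%E.
have mgp : measurable_fun setT (fun y : borelType X => (g y) `^ p)%E.
  exact: (measurableT_comp (measurable_poweR p)).
have mG : measurable_fun setT (G : borelType X -> \bar R).
  apply: (measurableT_comp (measurable_poweR p^-1)).
  exact: emeasurable_funD.
have G0 y : (0 <= G y)%E by exact: poweR_ge0.
have p1 : 0 <= p^-1 by rewrite invr_ge0 ltW.
have GE y : (`|G y| `^ p = g y `^ p + S y)%E.
  rewrite gee0_abs// -poweRrM mulVf ?gt_eqF// poweRe1//.
  by rewrite adde_ge0// poweR_ge0.
have rootle (u v : \bar R) : (0 <= u -> 0 <= v -> u `^ p <= v -> u <= v `^ p^-1)%E.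
  move=> u0 v0 uv; have := gt0_ler_poweR p1 _ _ uv.
  rewrite !in_itv /= !leey !andbT poweR_ge0 v0 => /(_ isT isT).
  by rewrite -poweRrM mulfV ?gt_eqF// poweRe1.
have sum0 y : (0 <= g y `^ p + S y)%E by rewrite adde_ge0// poweR_ge0.
have gG y : (g y <= G y)%E by apply: rootle => //; rewrite leeDl.
have rG n y : (r n y <= G y)%E.
  apply: rootle => //; apply: le_trans (leeDr _ (poweR_ge0 _ _)).
  rewrite /S (@nneseriesD1 _ _ n)// => [|k _]; last exact: poweR_ge0.
  by rewrite leeDl// nneseries_ge0// => k _ _; exact: poweR_ge0.
exists G; split=> //; last first.
  move=> c nc; have [cG|cG] := pselect (Gamma c); last first.
    by apply: le_trans (ugf _ nc cG) _; exact: le_curve_integral.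
  rewrite /upper_gradient_along; suff -> : curve_integral c G = +oo%E by rewrite leey.
  apply/eqyP => A A0; pose n := Num.truncn A.
  apply: (@le_trans _ _ (curve_integral c (r n))); last exact: le_curve_integral.
  have [[mrho rho0 rho1] _] := rhoP n.
  rewrite curve_integralZ//; apply: (@le_trans _ _ (n.+1%:R%:E * 1)%E); last first.
    by rewrite lee_wpmul2l// rho1.
  by rewrite mule1 lee_fin ltW// truncnS_gt.
move=> x s s0; under eq_integral do rewrite GE.
have mB := caratheodory_ball mms x s.
have toB (h : X -> \bar R) : measurable_fun setT (h : borelType X -> \bar R) ->
    measurable_fun (ball x s : set (muType mu)) (h : muType mu -> \bar R).
  move=> mh; apply: measurable_funTS.
  exact: measurable_fun_borel_caratheodory.
rewrite ge0_integralD//; last 3 first.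
- by move=> y _; exact: poweR_ge0.
- exact: (toB (fun y => g y `^ p)%E).
- exact: toB.
have m0 : 0 <= fine (mu (ball x s)) `^ (1 - p / q) by rewrite powR_ge0.
rewrite integral_nneseries//; last 2 first.
- by move=> n; exact: (toB (fun y => r n y `^ p)%E).
- by move=> n y _; exact: poweR_ge0.
have -> : M `^ p * fine (mu (ball x s)) `^ (1 - p / q) =
   M1 `^ p * fine (mu (ball x s)) `^ (1 - p / q) + d * fine (mu (ball x s)) `^ (1 - p / q).
  by rewrite -mulrDl [M1 `^ p + _]addrC subrK.
rewrite EFinD; apply: leeD.
  apply: le_trans (bg x s s0).
  by under [leRHS]eq_integral do rewrite gee0_abs//.
apply: le_trans (epsilon_trick0 xpredT _); last by rewrite mulr_ge0// ltW.
apply: lee_nneseries => [n _ _|n _]; first by apply: integral_ge0 => y _; exact: poweR_ge0.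
have := (rhoP n).2 x s s0; rewrite eE mulrAC; apply: le_trans.
by under [leRHS]eq_integral do rewrite gee0_abs ?r0//.
Qed.

End morrey.

(** * Segments of arc-length parametrized curves *)

Section polygonal_lengths.
Context {R : realType} {X : pmetricType R}.
Implicit Types (a b s t : R) (c : R -> X) (P : seq R).

Lemma polygonal_length_nil a b c : polygonal_length a b c [::] = 0.
Proof. by rewrite /polygonal_length big_nil. Qed.

Lemma polygonal_length_cons a b c x P : polygonal_length a b c (x :: P) =
  mdist (c a) (c x) + polygonal_length x b c P.
Proof. by rewrite /polygonal_length /= big_nat_recl. Qed.

Lemma polygonal_length_cat a b b' c P Q : polygonal_length a b c (P ++ Q) =
  polygonal_length a b' c P + polygonal_length (last a P) b c Q.
Proof.
elim: P a => [|x P IH] a /=; first by rewrite polygonal_length_nil add0r.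
by rewrite !polygonal_length_cons IH addrA.
Qed.

Lemma polygonal_length_shift s a b c P :
  polygonal_length a b (fun t => c (s + t)) P =
  polygonal_length (s + a) (s + b) c [seq s + x | x <- P].
Proof.
elim: P a => [|x P IH] a /=; first by rewrite !polygonal_length_nil.
by rewrite !polygonal_length_cons IH.
Qed.

Lemma polygonal_length_le_lipschitz a b c P :
  (forall s t, a <= s -> s < t -> t <= b -> mdist (c s) (c t) <= t - s) ->
  itv_partition a b P -> polygonal_length a b c P <= b - a.
Proof.
elim: P a => [|x P IH] a lip pP.
  by rewrite polygonal_length_nil (itv_partition_nil pP) subrr.
have xb := itv_partition_le (itv_partition_cons pP).
have ax : a < x by case: pP => /= /andP[].
rewrite polygonal_length_cons (_ : b - a = (x - a) + (b - x)); last by ring.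
rewrite lerD ?lip//; apply: IH (itv_partition_cons pP) => s t xs.
by apply: lip; rewrite (le_trans (ltW ax)).
Qed.

Lemma le_curve_length a b c P : itv_partition a b P ->
  ((polygonal_length a b c P)%:E <= curve_length a b c)%E.
Proof. by move=> pP; apply: ereal_sup_ubound; exists P. Qed.

(** A partition of [[0, s]] extended by the point [t] is a partition of
    [[0, t]], and the lengths of the two initial pieces are [s] and [t]. *)
Lemma mdist_le_arclength (g : curve X) s t : 0 <= s -> s < t -> t <= clength g ->
  mdist (g s) (g t) <= t - s.
Proof.
move=> s0 st tl; rewrite -lerN2 opprB -(lerD2l t) addrCA subrr addr0.
have Es : curve_length 0 s g = s%:E.
  by rewrite cpath_arclength// in_itv /= s0 (le_trans (ltW st)).
have Et : curve_length 0 t g = t%:E.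
  by rewrite cpath_arclength// in_itv /= tl andbT (le_trans s0)// ltW.
rewrite -lee_fin -Es; apply: ge_ereal_sup => _ [P pP <-]; rewrite lee_fin.
have := le_curve_length g (itv_partition_cat pP (itv_partition1 st)).
rewrite Et lee_fin (@polygonal_length_cat _ _ s) polygonal_length_cons.
case: pP => _ /eqP ->; rewrite polygonal_length_nil addr0.
by rewrite -lerBrDr.
Qed.

(** Additivity of length at [s], in the direction that is not immediate.
    Vertices before [s] contribute at most [s - a] since the curve is
    1-Lipschitz, and the edge that jumps over [s] is cut there by the triangle
    inequality.  The starting point [a] varies in the induction on the
    partition. *)
Lemma polygonal_length_split (g : curve X) s t a P :
  0 <= a -> a <= s -> 0 <= t -> s + t <= clength g ->
  itv_partition a (s + t) P ->
  ((polygonal_length a (s + t)%R g P)%:E <=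
   (s - a)%:E + curve_length 0 t (fun u => g (s + u)%R))%E.
Proof.
move=> + + t0 stl; elim: P a => [|x P IH] a a0 ale_s pP.
  have e := itv_partition_nil pP.
  have t00 : t = 0 by lra.
  rewrite polygonal_length_nil (_ : s - a = 0); last by lra.
  rewrite add0e t00.
  have nilP : itv_partition 0 0 ([::] : seq R) by split.
  have := le_curve_length (fun u => g (s + u)) nilP.
  by rewrite polygonal_length_nil.
have ax : a < x by case: pP => /= /andP[].
have xst := itv_partition_le (itv_partition_cons pP).
rewrite polygonal_length_cons; have [xs|sx] := leP x s.
  have x0 : 0 <= x by rewrite (le_trans a0)// ltW.
  have := IH x x0 xs (itv_partition_cons pP).
  rewrite (_ : s - a = (x - a) + (s - x)); last by ring.
  move=> h; rewrite EFinD (EFinD (x - a)) -addeA; apply: leeD h.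
  rewrite lee_fin mdist_le_arclength// (le_trans xst)//.
have s0 : 0 <= s by exact: le_trans ale_s.
apply: (@le_trans _ _ ((s - a)%:E + (polygonal_length s (s + t) g (x :: P))%:E)%E).
  rewrite polygonal_length_cons -EFinD lee_fin addrA lerD2r.
  apply: le_trans (metric_triangle _ (g s) _) _; rewrite lerD2r.
  move: ale_s; rewrite le_eqVlt => /predU1P[->|a_s]; first by rewrite mdistxx subrr.
  by rewrite mdist_le_arclength// (le_trans _ stl)// lerDl.
rewrite leeD2l//.
have -> : x :: P = [seq s + y | y <- [seq y - s | y <- x :: P]].
  by rewrite -map_comp map_id_in// => y _ /=; rewrite addrC subrK.
rewrite -[X in polygonal_length X](addr0 s) -polygonal_length_shift.
apply: le_curve_length; case: pP => /= /andP[_ pP] /eqP lP.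
split; last by rewrite /= (last_map (fun y => y - s)) lP addrC addKr.
rewrite /= subr_gt0 sx /= (@path_map _ _ (fun y => y - s)).
by apply: sub_path pP => y z /=; rewrite ltrD2r.
Qed.

End polygonal_lengths.

Section segments.
Context {R : realType} {X : pmetricType R}.
Variable g : curve X.

Lemma initial_arclength s (hs : s \in `[0, clength g]) t : t \in `[0, s] ->
  curve_length 0 t g = t%:E.
Proof.
rewrite !in_itv /= => /andP[t0 ts]; rewrite cpath_arclength// in_itv /= t0.
by move: hs; rewrite in_itv /= => /andP[_]; exact: le_trans.
Qed.

Lemma initial_continuous s (hs : s \in `[0, clength g]) :
  {within `[0, s], continuous g}.
Proof.
apply: continuous_subspaceW (@cpath_continuous _ _ g) => t /=.
rewrite !in_itv /= => /andP[-> ts] /=.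
by move: hs; rewrite in_itv /= => /andP[_]; exact: le_trans.
Qed.

Lemma initial_length_ge0 s (hs : s \in `[0, clength g]) : 0 <= s.
Proof. by move: hs; rewrite in_itv => /andP[]. Qed.

Definition initial_segment s (hs : s \in `[0, clength g]) : curve X :=
  Curve (initial_length_ge0 hs) (initial_continuous hs) (initial_arclength hs).

Let tail s (t : R) := g (s + t).

Lemma terminal_length_ge0 s (hs : s \in `[0, clength g]) : 0 <= clength g - s.
Proof. by move: hs; rewrite in_itv subr_ge0 => /andP[]. Qed.

Lemma terminal_lipschitz s (hs : s \in `[0, clength g]) u t :
  0 <= u -> u < t -> t <= clength g - s -> mdist (tail s u) (tail s t) <= t - u.
Proof.
move: hs; rewrite in_itv /= => /andP[s0 sl] u0 ut tl.
rewrite (_ : t - u = s + t - (s + u)); last by ring.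
by apply: mdist_le_arclength; lra.
Qed.

Lemma terminal_continuous s (hs : s \in `[0, clength g]) :
  {within `[0, clength g - s], continuous (tail s)}.
Proof.
apply/subspace_continuousP => u /=; rewrite in_itv /= => /andP[u0 ul].
apply/cvg_ballP => e e0; near=> t.
have : t \in `[0, clength g - s] by near: t; exact: withinT.
rewrite in_itv /= => /andP[t0 tl].
have : `|u - t| < e by near: t; apply: cvg_within; exact: nbhsx_ballx.
rewrite ballEmdist /=; case: (ltgtP u t) => [ut|tu|->].
- rewrite distrC gtr0_norm ?subr_gt0//; apply: le_lt_trans.
  exact: terminal_lipschitz.
- rewrite gtr0_norm ?subr_gt0//; apply: le_lt_trans.
  by rewrite metric_sym; exact: terminal_lipschitz.
- by rewrite mdistxx.
Unshelve. all: by end_near. Qed.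

(** Both bounds are needed: the Lipschitz property limits polygonal lengths
    from above, and additivity of length at [s] forces the supremum to reach
    [t]. *)
Lemma terminal_arclength s (hs : s \in `[0, clength g]) t :
  t \in `[0, clength g - s] -> curve_length 0 t (tail s) = t%:E.
Proof.
rewrite in_itv /= => /andP[t0 tl].
have := hs; rewrite in_itv /= => /andP[s0 sl].
apply/eqP; rewrite eq_le; apply/andP; split.
  apply: ge_ereal_sup => _ [P pP <-]; rewrite lee_fin -[leRHS]subr0.
  apply: polygonal_length_le_lipschitz pP => u v u0 uv vt.
  by apply: terminal_lipschitz => //; exact: le_trans tl.
have stl : s + t <= clength g by lra.
have : ((s + t)%:E <= s%:E + curve_length 0 t (tail s))%E.
  rewrite -(@cpath_arclength _ _ g (s + t)); last by rewrite in_itv /= addr_ge0.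
  apply: ge_ereal_sup => _ [P pP <-].
  by have := polygonal_length_split (lexx 0) s0 t0 stl pP; rewrite subr0.
by rewrite EFinD leeD2lE.
Qed.

Definition terminal_segment s (hs : s \in `[0, clength g]) : curve X :=
  Curve (terminal_length_ge0 hs) (terminal_continuous hs) (terminal_arclength hs).

End segments.

(** * Values at the endpoints of a curve *)

Section integrals_on_the_line.
Context {R : realType}.
Notation lambda := (@lebesgue_measure R).
Implicit Types (s t l : R) (h : R -> \bar R).

Lemma measurable_shift s :
  @measurable_fun _ _ (measurableTypeR R) (measurableTypeR R) setT
    (fun t : R => s + t).
Proof. exact: measurable_funD. Qed.

(** Translating the parameter is needed because a terminal segment of a curve
    is parametrized from [0] again. *)
Lemma lebesgue_measure_shift s (A : set R) : measurable A ->
  pushforward lambda (fun t => s + t : measurableTypeR R) A = lambda A.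
Proof.
move=> mA; apply/esym.
pose mshift := isMeasurableFun.Build _ _ (measurableTypeR R) (measurableTypeR R)
  (fun t : R => s + t) (measurable_shift s).
pose shift : {mfun measurableTypeR R >-> measurableTypeR R} :=
  HB.pack (fun t : R => s + t) mshift.
apply: (@lebesgue_measure_unique R (pushforward lambda shift)) => //=.
move=> _ [[a b]] _ <-; rewrite /pushforward /=.
rewrite (_ : _ @^-1` _ = `]a - s, b - s]%classic); last first.
  by apply/seteqP; split => t /=; rewrite !in_itv /= ltrBlDl lerBrDl.
rewrite !lebesgue_measure_itv /= !lte_fin ltrD2r.
by case: ifP => // _; rewrite -!EFinB; congr EFin; ring.
Qed.

Lemma ge0_integral_shift h s l : s <= l ->
  measurable_fun (`[s, l] : set R) h ->
  (forall t, t \in `[s, l] -> 0 <= h t)%E ->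
  (\int[lambda]_(t in `[0%R, (l - s)%R]) h (s + t)%R = \int[lambda]_(t in `[s, l]) h t)%E.
Proof.
move=> sl mh h0.
have -> : (`[0, l - s] : set R)%classic = (fun t => s + t) @^-1` `[s, l].
  by apply/seteqP; split => t /=; rewrite !in_itv /= lerDl lerBrDl.
rewrite -[LHS](@ge0_integral_pushforward _ _ _ _ R _ (measurable_shift s) lambda _ h)//.
- apply: eq_measure_integral => [|mphi A mA _]; first exact: measurable_shift.
  exact: lebesgue_measure_shift.
- by move=> t /set_mem; exact: h0.
Qed.

(** Absolute continuity of the integral.  The function may be infinite on a
    null set, so it is first replaced by its finite part. *)
Lemma integral_small_sets h l : 
  measurable_fun (`[0, l] : set R) h ->
  (forall t, t \in `[0, l] -> (0 <= h t)%E) ->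
  (\int[lambda]_(t in `[0%R, l]) h t < +oo)%E ->
  forall e : R, 0 < e -> exists2 d : R, 0 < d &
    forall A : set R, measurable A -> A `<=` `[0, l] -> (lambda A < d%:E)%E ->
      (\int[lambda]_(t in A) h t < e%:E)%E.
Proof.
move=> mh h0 hfin e e0.
have mD : measurable (`[0, l]%classic : set (measurableTypeR R)) by [].
have ih : lambda.-integrable `[0, l] h.
  apply/integrableP; split => //.
  by under eq_integral => t /set_mem tD do rewrite gee0_abs ?h0//.
pose H := h \_ `[0, l].
have iH : lambda.-integrable setT H.
  by have := @integrable_mkcond _ _ _ lambda _ h mD => -[+ _]; apply.
have H0 t : (0 <= H t)%E.
  by apply: erestrict_ge0 => u; exact: h0.
have mH : measurable_fun setT H := measurable_int _ iH.
have mf : measurable_fun setT (fine \o H).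
  exact: measurableT_comp.
have iF : lambda.-integrable setT (EFin \o (fine \o H)).
  apply: le_integrable iH => //; first exact/measurable_EFinP.
  move=> t _ /=; rewrite ger0_norm ?fine_ge0// gee0_abs//.
  by case: (H t) (H0 t) => //= *; rewrite leey.
have [d [d0 dP]] := integral_normr_continuous iF e0.
exists d => // A mA AD Ad; have := dP A mA Ad.
rewrite /Rintegral => lt_e.
have Efin : (\int[lambda]_(t in A) (`|(fine \o H) t|)%:E)%E \is a fin_num.
  by apply: integrable_fin_num => //; apply: integrable_norm; apply: integrableS iF.
have -> : (\int[lambda]_(t in A) h t = \int[lambda]_(t in A) (`|(fine \o H) t|)%:E)%E.
  apply: ge0_ae_eq_integral => //.
  - exact: measurable_funS mh.
  - apply/measurable_EFinP; apply: measurableT_comp => //.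
    exact: measurable_funS mf.
  - by move=> t /AD; exact: h0.
  have [N [mN N0 NP]] := integrable_ae mD ih.
  exists N; split => // t /= nt; apply: NP => /= ft; apply: nt => At.
  have tD : t \in `[0, l] := AD _ At.
  have -> : H t = h t by rewrite /H patchE mem_set.
  by rewrite ger0_norm ?fine_ge0 ?h0// fineK// ft.
by rewrite -(fineK Efin) lte_fin.
Qed.

(** The control of [u] by small integrals of [h] makes [u] continuous at
    [t0].  The points where [u] and [v] differ are contained in the null set
    where [h] is infinite, so points of agreement accumulate at [t0]. *)
Lemma agree_by_integral_control (u v : R -> R) h l t0 : 0 < l -> t0 \in `[0, l] ->
  measurable_fun (`[0, l] : set R) h ->
  (forall t, t \in `[0, l] -> (0 <= h t)%E) ->
  (\int[lambda]_(t in `[0%R, l]) h t < +oo)%E ->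
  {within `[0, l], continuous v} ->
  (forall t, t \in `[0, l] -> u t <> v t -> h t = +oo%E) ->
  (forall t, t \in `[0, l] -> t != t0 -> exists A : set R,
     [/\ measurable A, A `<=` `[0, l], (lambda A <= (`|t - t0|)%:E)%E &
      ((`|u t0 - u t|)%:E <= \int[lambda]_(t in A) h t)%E]) ->
  u t0 = v t0.
Proof.
move=> l0 t0l mh h0 hfin cv huv hu; apply: contrapT => neq.
pose e := `|u t0 - v t0| / 2.
have e0 : 0 < e by rewrite divr_gt0// normr_gt0 subr_eq0; apply/eqP.
have [d d0 dP] := integral_small_sets mh h0 hfin e0.
move/subspace_continuousP : cv => /(_ _ t0l) /cvg_ballP /(_ _ e0) [d2 /= d20 vP].
pose d3 := Num.min d d2.
have d30 : 0 < d3 by rewrite lt_min d0.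
have [a [b [ab abP]]] : exists a b : R, a < b /\ forall t, a < t < b ->
    [/\ t \in `[0, l], t != t0 & `|t - t0| < d3].
  move: t0l; rewrite in_itv /= => /andP[t00 t0l].
  have [t0ltl|] := ltP t0 l.
    exists t0, (Num.min l (t0 + d3)); split.
      by rewrite lt_min t0ltl ltrDl.
    move=> t /andP[t0t]; rewrite lt_min => /andP[tl td].
    rewrite in_itv /= (ltW tl) (le_trans t00 (ltW t0t)) gt_eqF//; split => //.
    by rewrite gtr0_norm ?subr_gt0// ltrBlDl.
  move=> lt0; exists (Num.max 0 (t0 - d3)), t0; split.
    by rewrite gt_max gtrBl d30 andbT; exact: lt_le_trans lt0.
  move=> t /andP[]; rewrite gt_max => /andP[t0' td] tt0.
  rewrite in_itv /= (ltW t0') (le_trans (ltW tt0) t0l) lt_eqF//; split => //.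
  by rewrite distrC gtr0_norm ?subr_gt0// ltrBlDl -ltrBlDr.
have [t tab huvt] : exists2 t, a < t < b & u t = v t.
  apply: contrapT => nt.
  have mD : measurable (`[0, l]%classic : set (measurableTypeR R)) by [].
  have ih : lambda.-integrable `[0, l] h.
    apply/integrableP; split => //.
    by under eq_integral => t /set_mem tD do rewrite gee0_abs ?h0//.
  have [N [mN N0 NP]] := integrable_ae mD ih.
  have : (lambda `]a, b[%classic <= lambda N)%E.
    apply: le_measure; rewrite ?inE//.
    move=> t /=; rewrite in_itv /= => tab; apply: NP => /= ft.
    have [tD _ _] := abP t tab.
    have ht : h t = +oo%E.
      by apply: huv => // E; apply: nt; exists t.
    by have := ft tD; rewrite ht.
  by rewrite N0 lebesgue_measure_itv /= lte_fin ab lee_fin subr_le0 leNgt ab.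
have [tD tt0 td3] := abP t tab.
have [A [mA AD lA uA]] := hu t tD tt0.
move: td3; rewrite lt_min => /andP[td td2].
have : `|u t0 - u t| < e.
  rewrite -lte_fin; apply: le_lt_trans uA _; apply: dP => //.
  by apply: le_lt_trans lA _; rewrite lte_fin.
have : ball (v t0) e (v t).
  by apply: vP => //=; rewrite /ball /= distrC.
rewrite /ball /= -huvt => h1 h2.
have : `|u t0 - v t0| < e + e.
  rewrite (_ : u t0 - v t0 = (u t0 - u t) + (u t - v t0)); last by ring.
  by apply: le_lt_trans (ler_normD _ _) _; rewrite ltrD// distrC.
by rewrite /e -mulr2n -[X in _ < X]mulr_natr divfK ?pnatr_eq0// ltxx.
Qed.

End integrals_on_the_line.

Section endpoints.
Context {R : realType} {X : pmetricType R}.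

Lemma continuous_along_curve (g : curve X) (f : X -> R) : continuous f ->
  {within `[0, clength g], continuous (f \o g)}.
Proof.
move=> cf t; apply: (@continuous_comp (subspace `[0, clength g]) X R g f).
  exact: (@cpath_continuous _ _ g).
exact: cf.
Qed.

(** The upper gradient inequality for the initial segments of [g] controls
    [f0] near the starting point, and the one for the terminal segments
    controls it near the end point. *)
Lemma endpoints_agree (g : curve X) (f0 f : X -> R) (G : X -> \bar R) :
  ~ constant_curve g -> continuous f ->
  measurable_fun setT (G : borelType X -> \bar R) -> (forall x, 0 <= G x)%E ->
  (curve_integral g G < +oo)%E ->
  (forall c : curve X, ~ constant_curve c -> upper_gradient_along f0 G c) ->
  (forall x, f0 x <> f x -> G x = +oo%E) ->
  f0 (g 0) = f (g 0) /\ f0 (g (clength g)) = f (g (clength g)).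
Proof.
move=> nc cf mG G0 Gfin ugf neqG.
have l0 : 0 < clength g.
  by rewrite lt_neqAle clength_ge0 andbT eq_sym; apply/eqP.
have mGg := measurable_along_curve (g := g) mG.
have cfg := continuous_along_curve (g := g) cf.
split.
- apply: (@agree_by_integral_control _ (f0 \o g) (f \o g) (G \o g) _ 0 l0) => //=.
  + by rewrite in_itv /= lexx ltW.
  + by move=> t _; exact: neqG.
  move=> t tl tn0; exists `[0, t]%classic.
  have := tl; rewrite in_itv /= => /andP[t0 tlg].
  split => //.
  + by move=> r /=; rewrite !in_itv /= => /andP[-> /le_trans]; exact.
  + rewrite lebesgue_measure_itv /= lte_fin lt_neqAle eq_sym tn0 t0/=.
    by rewrite sube0 subr0 ger0_norm.
  + apply: (ugf (initial_segment tl)) => /= /eqP.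
    by rewrite /constant_curve /= (negPf tn0).
- apply: (@agree_by_integral_control _ (f0 \o g) (f \o g) (G \o g) _ _ l0) => //=.
  + by rewrite in_itv /= lexx ltW.
  + by move=> t _; exact: neqG.
  move=> t tl tn0; exists `[t, clength g]%classic.
  have := tl; rewrite in_itv /= => /andP[t0 tlg].
  have tsub : `[t, clength g]%classic `<=` `[0, clength g].
    by move=> r /=; rewrite !in_itv /= => /andP[/(le_trans t0) ->].
  split => //.
  + rewrite lebesgue_measure_itv /= lte_fin lt_neqAle tn0 tlg/=.
    by rewrite -EFinB lee_fin distrC ger0_norm ?subr_ge0.
  + have := ugf (terminal_segment tl); rewrite /upper_gradient_along /=.
    rewrite addr0 (addrC t) subrK distrC /curve_integral /=.
    rewrite (@ge0_integral_shift _ (G \o g))//; last 2 first.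
    * exact: measurable_funS mGg.
    * by move=> r _; exact: G0.
    by apply; rewrite /constant_curve /=; apply/eqP; rewrite subr_eq0 eq_sym.
Qed.

End endpoints.

(** * Continuous representatives in a Newton-Morrey class *)

Section null_sets.
Context {R : realType} {X : pmetricType R}.
Variable mu : {outer_measure set X -> \bar R}.
Hypothesis mms : metric_measure_axioms mu.
Implicit Types (E : set X).

(** Borel regularity provides a measurable null set that contains [E]. *)
Lemma null_negligible E : mu E = 0%E -> (measure_of mu).-negligible E.
Proof.
move=> E0; case: mms => -[_ reg] _ _ _; have [B [mB EB muB]] := reg E.
exists B; split => //; last by rewrite -E0 -muB.
exact: measurable_borel_caratheodory.
Qed.

Lemma negligible_null E : (measure_of mu).-negligible E -> mu E = 0%E.
Proof.
move=> [B [_ B0 EB]]; apply/eqP; rewrite eq_le outer_measure_ge0 andbT.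
by rewrite -B0; exact: le_outer_measure.
Qed.

Lemma null_of_balls E (x : X) :
  (forall r : R, 0 < r -> mu (E `&` ball x r) = 0%E) -> mu E = 0%E.
Proof.
move=> h; apply: negligible_null.
have -> : E = \bigcup_n (E `&` ball x n.+1%:R).
  rewrite -setI_bigcupr -[LHS]setIT; congr setI; apply/esym/seteqP; split => // y _.
  exists (Num.truncn (mdist x y)) => //=.
  by rewrite ballEmdist /=; exact: truncnS_gt.
by apply: negligible_bigcup => n; apply: null_negligible; rewrite h.
Qed.

Lemma ae_eq_null (T : Type) (f g : X -> T) D : mu [set x | f x <> g x] = 0%E ->
  ae_eq (measure_of mu) D f g.
Proof.
move=> /null_negligible; apply: negligibleS => x /= nD fg.
by apply: nD => _.
Qed.

Lemma continuous_measurable_caratheodory (f : X -> R) : continuous f ->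
  measurable_fun [set: muType mu] (f : muType mu -> R).
Proof.
move=> /continuousP cf; apply: (measurability _ (RGenOpens.measurableE R)).
move=> _ [_ [a [b ->] <-]]; rewrite setTI.
exact/(open_caratheodory mms)/cf/interval_open.
Qed.

End null_sets.

Section classes.
Context {R : realType} {X : pmetricType R}.
Variable mu : {outer_measure set X -> \bar R}.
Hypothesis mms : metric_measure_axioms mu.
Variables p q : R.
Hypothesis p_gt0 : 0 < p.
Implicit Types (f h : X -> R) (G : X -> \bar R).

Lemma measurable_norm_power (G : muType mu -> \bar R) (D : set (muType mu)) :
  measurable_fun setT G -> measurable_fun D (fun y => `|G y| `^ p)%E.
Proof.
move=> mG; apply: measurable_funTS.
apply: (@measurableT_comp _ _ _ _ _ _ (fun y : \bar R => y `^ p)%E).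
  exact: measurable_poweR.
exact: measurableT_comp.
Qed.

Lemma eq_morrey_norm f h :
  measurable_fun [set: muType mu] (f : muType mu -> R) ->
  measurable_fun [set: muType mu] (h : muType mu -> R) ->
  mu [set x | f x <> h x] = 0%E ->
  morrey_norm mu p q (EFin \o f) = morrey_norm mu p q (EFin \o h).
Proof.
move=> mf mh fh.
have E x r : (\int[measure_of mu]_(y in ball x r) (`|(EFin \o f) y| `^ p) =
             \int[measure_of mu]_(y in ball x r) (`|(EFin \o h) y| `^ p))%E.
  apply: ge0_ae_eq_integral.
  - exact: (caratheodory_ball mms).
  - exact/measurable_norm_power/measurable_EFinP.
  - exact/measurable_norm_power/measurable_EFinP.
  - by move=> y _; exact: poweR_ge0.
  - by move=> y _; exact: poweR_ge0.
  - apply: (ae_eq_null mms); apply/eqP; rewrite eq_le outer_measure_ge0 andbT -fh.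
    by apply: le_outer_measure => y /= ne fhy; apply: ne; rewrite fhy.
apply/eqP; rewrite eq_le; apply/andP.
split; apply: ge_ereal_sup => _ [u u0 <-].
  rewrite E.
  by apply: ereal_sup_ubound; exists u.
rewrite -E.
by apply: ereal_sup_ubound; exists u.
Qed.

Lemma morrey_norm0 G : (forall x, G x = 0%E) -> morrey_norm mu p q G = 0%E.
Proof.
move=> G0; apply/eqP; rewrite eq_le morrey_norm_ge0 andbT.
apply/(morrey_normP mms q p_gt0 _ (lexx 0)) => x r r0.
rewrite powR0 ?gt_eqF// mul0r integral0_eq//= => y _.
by rewrite G0 /= normr0 powR0// gt_eqF.
Qed.

Lemma morrey_norm0_null h : 
  measurable_fun [set: muType mu] (h : muType mu -> R) ->
  morrey_norm mu p q (EFin \o h) = 0%E -> mu [set x | h x <> 0] = 0%E.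
Proof.
move=> mh h0; apply: (null_of_balls mms (x := point)) => r r0.
have /(morrey_normP mms q p_gt0) b0 : (morrey_norm mu p q (EFin \o h) <= 0%:E)%E.
  by rewrite h0.
have := b0 (lexx 0) point r r0; rewrite powR0 ?gt_eqF// mul0r => le0.
have int0 : (\int[measure_of mu]_(y in ball (point : X) r) (`|(EFin \o h) y| `^ p) = 0)%E.
  apply/eqP; rewrite eq_le le0 andTb.
  by apply: integral_ge0 => y _; exact: poweR_ge0.
have mhp : measurable_fun (ball (point : X) r : set (muType mu)) 
    (fun y : muType mu => (`|(EFin \o h) y| `^ p)%E).
  exact/measurable_norm_power/measurable_EFinP.
have /(ae_eq_integral_abs (measure_of mu) (caratheodory_ball mms _ _) mhp) :
  (\int[measure_of mu]_(y in ball (point : X) r) `|(`|(EFin \o h) y| `^ p)| = 0)%E.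
  by rewrite -[RHS]int0; apply: eq_integral => y _; rewrite gee0_abs ?poweR_ge0.
move=> h1; apply: negligible_null; apply: negligibleS h1 => y /= [hy By] /(_ By).
by move=> [/powR_eq0_eq0/normr0_eq0]; exact: hy.
Qed.

(** Every positive multiple of [G] is admissible for this family. *)
Lemma infinite_integral_modulus0 G M : 0 <= M ->
  measurable_fun setT (G : borelType X -> \bar R) -> (forall x, 0 <= G x)%E ->
  morrey_bound mu p q G M ->
  morrey_modulus mu p q [set c | curve_integral c G = +oo%E] = 0%E.
Proof.
move=> M0 mG G0 bG; apply/eqP; rewrite eq_le; apply/andP; split; last first.
  by apply: le_ereal_inf_tmp => _ [rho _ <-]; exact: poweR_ge0.
apply/lee_addgt0Pr => e e0; rewrite add0e.
pose k := e `^ p^-1 / (M + 1).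
have k0 : 0 < k by rewrite divr_gt0 ?powR_gt0// ltr_wpDl.
have kM : k * M <= e `^ p^-1.
  rewrite /k mulrAC ler_pdivrMr ?ltr_wpDl// ler_wpM2l ?powR_ge0//.
  by rewrite lerDl.
apply: (@le_trans _ _ (morrey_norm mu p q (fun y => k%:E * G y)%E `^ p)%E).
  apply: ereal_inf_lbound; exists (fun y => k%:E * G y)%E => //; split.
  - exact: measurable_funeM.
  - by move=> x; rewrite mule_ge0// lee_fin ltW.
  - move=> c /= cG; rewrite curve_integralZ//; last exact: ltW.
    by rewrite cG gt0_muley ?lte_fin// leey.
have bk := morrey_boundZ mms (ltW k0) M0 (measurable_fun_borel_caratheodory mms mG) bG.
have kM0 : 0 <= k * M by rewrite mulr_ge0// ltW.
have /(morrey_normP mms q p_gt0 _ kM0) nk := bk.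
apply: (@le_trans _ _ ((k * M)%:E `^ p)%E).
  apply: gt0_ler_poweR nk; first exact: ltW.
  - by rewrite in_itv /= morrey_norm_ge0 leey.
  - by rewrite in_itv /= lee_fin kM0 leey.
rewrite poweR_EFin lee_fin.
rewrite -[leRHS](_ : (e `^ p^-1) `^ p = e); last first.
  by rewrite -powRrM mulVf ?gt_eqF// powRr1// ltW.
by apply: ge0_ler_powR; rewrite ?nnegrE ?powR_ge0// ltW.
Qed.

Lemma inf_upper_gradients_ge0 f :
  (0 <= ereal_inf [set morrey_norm mu p q rho |
                   rho in weak_upper_gradient mu p q f])%E.
Proof. by apply: le_ereal_inf_tmp => _ [rho _ <-]; exact: morrey_norm_ge0. Qed.

Lemma prenorm_ge0 f : (0 <= prenorm mu p q f)%E.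
Proof. by rewrite adde_ge0 ?morrey_norm_ge0 ?inf_upper_gradients_ge0. Qed.

Lemma prenorm_lty f : (prenorm mu p q f < +oo)%E ->
  (morrey_norm mu p q (EFin \o f) < +oo)%E /\
  exists2 g, weak_upper_gradient mu p q f g & (morrey_norm mu p q g < +oo)%E.
Proof.
move=> h; split.
  apply: le_lt_trans h; rewrite leeDl//; exact: inf_upper_gradients_ge0.
have : (ereal_inf [set morrey_norm mu p q rho |
                   rho in weak_upper_gradient mu p q f] < +oo)%E.
  by apply: le_lt_trans h; rewrite leeDr//; exact: morrey_norm_ge0.
by move=> /ereal_inf_lt[_ [g wg <-] glt]; exists g.
Qed.

(** Equality almost everywhere is weaker than equality in the Newton-Morrey
    class.  The Borel function [H] is an upper gradient of [f0] that is
    infinite wherever [f] and [f0] may differ.  The curves along which its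
    integral is infinite form a family of modulus zero, and outside of it [f]
    and [f0] agree at the endpoints: hence [H] is a weak upper gradient of [f]
    and [0] is one of [f - f0]. *)
Lemma continuous_representative f0 f : NMtilde mu p q f0 -> continuous f ->
  mu [set x | f0 x <> f x] = 0%E -> NMclass mu p q f0 f.
Proof.
move=> [mf0 /prenorm_lty[f0fin [g wg gfin]]] cf null.
have mf := continuous_measurable_caratheodory mms cf.
have nulls : mu [set x | f x <> f0 x] = 0%E.
  by rewrite -null; congr (mu _); apply/seteqP; split => x /=; exact: nesym.
pose M := fine (morrey_norm mu p q g) + 1.
have fine0 : 0 <= fine (morrey_norm mu p q g) by rewrite fine_ge0// morrey_norm_ge0.
have M0 : 0 <= M by rewrite addr_ge0.
have gM : (morrey_norm mu p q g < M%:E)%E.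
  have gf : morrey_norm mu p q g \is a fin_num.
    by rewrite ge0_fin_numE ?morrey_norm_ge0.
  by rewrite -(fineK gf) lte_fin /M ltrDl.
have [G [mG G0 bG ugG]] := genuine_upper_gradient mms p_gt0 wg gM.
case: mms => -[_ reg] _ _ _.
have [B [mB EB muB]] := reg [set x | f0 x <> f x]; rewrite null in muB.
pose H x := if x \in B then +oo%E else G x.
have H0 x : (0 <= H x)%E by rewrite /H; case: ifP.
have GH x : (G x <= H x)%E by rewrite /H; case: ifP => // _; rewrite leey.
have mH : measurable_fun setT (H : borelType X -> \bar R).
  apply: measurable_fun_ifT => //; apply: (measurable_fun_bool true).
  rewrite setTI (_ : _ @^-1` _ = B)//.
  by apply/seteqP; split => x; [move/set_mem|move/mem_set].
have mHB (K : X -> \bar R) x r : measurable_fun setT (K : borelType X -> \bar R) ->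
    measurable_fun (ball x r : set (muType mu)) (fun y : muType mu => `|K y| `^ p)%E.
  move=> mK; apply: measurable_norm_power.
  exact: (measurable_fun_borel_caratheodory mms).
have bH : morrey_bound mu p q H M.
  move=> x r r0; apply: le_trans (bG x r r0); rewrite le_eqVlt; apply/orP; left; apply/eqP.
  apply: ge0_ae_eq_integral.
  - exact: (caratheodory_ball mms).
  - exact: (mHB H).
  - exact: (mHB G).
  - by move=> y _; exact: poweR_ge0.
  - by move=> y _; exact: poweR_ge0.
  - apply: (ae_eq_null mms); apply/eqP; rewrite eq_le outer_measure_ge0 andbT -muB.
    apply: le_outer_measure => y /=; apply: contra_notP => nBy.
    by rewrite /H memNset.
have ugH (c : curve X) : ~ constant_curve c -> upper_gradient_along f0 H c.
  by move=> nc; apply: le_trans (ugG _ nc) _; exact: le_curve_integral.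
have neqH x : f0 x <> f x -> H x = +oo%E.
  by move=> ne; rewrite /H mem_set//; exact: EB.
have ends (c : curve X) : ~ constant_curve c -> ~ curve_integral c H = +oo%E ->
    f0 (c 0) = f (c 0) /\ f0 (c (clength c)) = f (c (clength c)).
  move=> nc /eqP cH; apply: (endpoints_agree nc cf mH H0 _ ugH neqH).
  by rewrite ltey.
have mod0 := infinite_integral_modulus0 M0 mH H0 bH.
have nfe : morrey_norm mu p q (EFin \o f) = morrey_norm mu p q (EFin \o f0).
  exact: eq_morrey_norm.
have wfH : weak_upper_gradient mu p q f H.
  split; [exact: mH|exact: H0|].
  exists [set c | curve_integral c H = +oo%E]; first exact: mod0.
  move=> c nc cH.
  have [e1 e2] := ends _ nc cH.
  by rewrite /upper_gradient_along -e1 -e2; exact: ugH.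
split.
  split; first exact: mf.
  rewrite /prenorm nfe; apply: lte_add_pinfty; first exact: f0fin.
  apply: (@le_lt_trans _ _ (morrey_norm mu p q H)).
    by apply: ereal_inf_lbound; exists H.
  have /(morrey_normP mms q p_gt0 _ M0) := bH; move=> /le_lt_trans; apply.
  exact: ltry.
apply/eqP; rewrite eq_le prenorm_ge0 andbT -[leRHS]adde0; apply: leeD.
  rewrite (@eq_morrey_norm _ (cst 0)).
  - by rewrite morrey_norm0.
  - exact: measurable_funB.
  - exact: measurable_cst.
  - rewrite -[RHS]nulls; congr (mu _); apply/seteqP; split => x /=.
      by apply: contra_not => ->; rewrite subrr.
    by move=> ne /eqP; rewrite subr_eq0 => /eqP.
suff wug0 : weak_upper_gradient mu p q (f \- f0) (fun=> 0%E).
  have n0 : morrey_norm mu p q (fun=> 0%E) = 0%E by apply: morrey_norm0.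
  rewrite -[leRHS]n0; apply: ereal_inf_lbound.
  by exists (fun=> 0%E); [exact: wug0|reflexivity].
split; [exact: measurable_cst|by []|].
exists [set c | curve_integral c H = +oo%E]; first exact: mod0.
move=> c nc cH; have [e1 e2] := ends _ nc cH.
by rewrite /upper_gradient_along /= -e1 -e2 !subrr normr0 curve_integral_ge0.
Qed.

Lemma NMclass_ae f0 h : NMtilde mu p q f0 -> NMclass mu p q f0 h ->
  mu [set x | h x <> f0 x] = 0%E.
Proof.
move=> [mf0 _] [[mh _] hf].
have : morrey_norm mu p q (EFin \o (h \- f0)) = 0%E.
  apply/eqP; rewrite eq_le morrey_norm_ge0 andbT -hf leeDl//.
  exact: inf_upper_gradients_ge0.
move=> /morrey_norm0_null => /(_ (measurable_funB mh mf0)) <-.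
congr (mu _); apply/seteqP; split => x /=.
  by move=> ne /eqP; rewrite subr_eq0 => /eqP.
by apply: contra_not => ->; rewrite subrr.
Qed.

End classes.

(** * Separated sets and averages over balls *)

Section covering.
Context {R : realType} {X : pmetricType R}.
Variable mu : {outer_measure set X -> \bar R}.
Hypothesis mms : metric_measure_axioms mu.
Implicit Types (x y z : X) (r : R).

Lemma measurable_balls (s : seq X) r :
  mu.-cara.-measurable (\big[setU/set0]_(x <- s) ball x r).
Proof.
elim/big_ind: _ => [|A B|x _]; first exact: measurable0.
- exact: measurableU.
- exact: caratheodory_ball.
Qed.

Lemma sum_disjoint_balls (s : seq X) r :
  pairwise (fun x y => r <= mdist x y) s ->
  (\sum_(x <- s) fine (mu (ball x (r / 2))))%:E =
  mu (\big[setU/set0]_(x <- s) ball x (r / 2)).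
Proof.
elim: s => [_|x s IH /= /andP[/allP xs ps]]; first by rewrite !big_nil outer_measure0.
rewrite !big_cons EFinD IH// fineK ?measure_ball_fin//.
apply/esym; apply: (measureU (measure_of mu)).
- exact: caratheodory_ball.
- exact: measurable_balls.
- rewrite -subset0 => z [xz]; rewrite -bigcup_seq => -[y /= /xs xy yz].
  rewrite ballEmdist /= in xz; rewrite ballEmdist /= metric_sym in yz.
  have := le_lt_trans (metric_triangle x z y) (ltrD xz yz).
  by rewrite -splitr ltNge xy.
Qed.

(** A maximal r-separated set in a ball.  It is finite because the balls of
    radius [r / 2] around its points are disjoint, contained in a ball of
    finite measure, and of measure at least [c]; maximality makes the balls of
    radius [r] cover. *)
Lemma separated_covering (x0 : X) (r0 r c : R) : 0 < r -> 0 < c ->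
  (forall x, c <= fine (mu (ball x (r / 2)))) ->
  exists s : seq X, ball x0 r0 `<=` \big[setU/set0]_(x <- s) ball x r /\
    \sum_(x <- s) fine (mu (ball x (r / 2))) <= fine (mu (ball x0 (r0 + r))).
Proof.
move=> r_gt0 c_gt0 hc.
pose sep (s : seq X) := pairwise (fun x y => r <= mdist x y) s /\
  (forall x, x \in s -> ball x0 r0 x).
have sum_le s : sep s ->
    \sum_(x <- s) fine (mu (ball x (r / 2))) <= fine (mu (ball x0 (r0 + r))).
  move=> [ps sB]; rewrite -lee_fin sum_disjoint_balls// fineK ?measure_ball_fin//.
  apply: le_outer_measure => z; rewrite -bigcup_seq => -[y /= /sB yB].
  apply: subset_ball; rewrite ballEmdist /= in yB; lra.
have size_le s : sep s -> (size s <= Num.truncn (fine (mu (ball x0 (r0 + r))) / c))%N.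
  move=> /sum_le h; rewrite truncn_ge_nat; last first.
    by rewrite divr_ge0 ?fine_ge0 ?outer_measure_ge0// ltW.
  rewrite ler_pdivlMr//; apply: le_trans h.
  rewrite mulr_natl -iter_addr_0 -count_predT -big_const_seq.
  by apply: ler_sum => x _; exact: hc.
have ex0 : exists n, `[< exists s, sep s /\ size s = n >].
  by exists 0%N; apply/asboolP; exists [::].
have bounded n : `[< exists s, sep s /\ size s = n >] ->
    (n <= Num.truncn (fine (mu (ball x0 (r0 + r))) / c))%N.
  by move=> /asboolP[s [/size_le + <-]].
case: (ex_maxnP ex0 bounded) => n /asboolP[s [seps sn]] maxn.
exists s; split; last exact: sum_le.
move=> z zB; rewrite -bigcup_seq; apply: contrapT => nz.
have : (n.+1 <= n)%N; last by rewrite ltnn.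
apply: maxn; apply/asboolP; exists (z :: s); split; last by rewrite /= sn.
case: seps => ps sB; split; last by move=> x; rewrite inE => /predU1P[->//|/sB].
rewrite /= ps andbT; apply/allP => y ys; rewrite leNgt; apply/negP => zy.
by apply: nz; exists y => //; rewrite ballEmdist /= metric_sym.
Qed.

End covering.

Section averages.
Context {R : realType} {X : pmetricType R}.
Variable mu : {outer_measure set X -> \bar R}.
Hypothesis mms : metric_measure_axioms mu.
Implicit Types (x y z : X) (r s : R) (h : X -> R).

Definition average h x r : R := fine (mean mu (ball x r) (EFin \o h)).

Definition locally_integrable h := forall x r,
  (measure_of mu).-integrable (ball x r : set (muType mu)) (EFin \o h).

Lemma meanE (G : X -> \bar R) x r : 0 < r ->
  mean mu (ball x r) G = (((fine (mu (ball x r)))^-1)%:E *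
    \int[measure_of mu]_(y in ball x r) G y)%E.
Proof.
move=> r0; rewrite /mean -[X in (X^-1)%E](fineK (measure_ball_fin mms x r)) inver.
by rewrite gt_eqF// fine_measure_ball_gt0.
Qed.

Lemma integrable_ball_cst x r (c : R) :
  (measure_of mu).-integrable (ball x r : set (muType mu)) (EFin \o cst c).
Proof.
apply/integrableP; split; first exact/measurable_EFinP/measurable_cst.
rewrite (integral_cst (measure_of mu) (caratheodory_ball mms x r) `|c|%:E).
by rewrite lte_mul_pinfty//; exact: measure_ball_lty.
Qed.

Lemma integrable_dist h x r (c : R) : locally_integrable h ->
  (measure_of mu).-integrable (ball x r : set (muType mu)) (fun y => (h y - c)%:E).
Proof.
move=> ih.
have -> : (fun y => (h y - c)%:E) = ((EFin \o h) \- (fun _ : X => c%:E))%E.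
  by apply/funext => y; rewrite EFinB.
apply: integrableB; [exact: caratheodory_ball|exact: ih|exact: integrable_ball_cst].
Qed.

Lemma average_dist_le h x r (c : R) : 0 < r -> locally_integrable h ->
  ((`|average h x r - c| * fine (mu (ball x r)))%:E <=
   \int[measure_of mu]_(y in ball x r) (`|h y - c|)%:E)%E.
Proof.
move=> r0 ih; have m0 := fine_measure_ball_gt0 mms x r0.
have mB := caratheodory_ball mms x r.
have Ifin : (\int[measure_of mu]_(y in ball x r) (EFin \o h) y)%E \is a fin_num.
  exact: integrable_fin_num.
have icst := integrable_ball_cst x r c.
have E : (\int[measure_of mu]_(y in ball x r) (h y - c)%:E =
          ((average h x r - c) * fine (mu (ball x r)))%:E)%E.
  under eq_integral do rewrite EFinB.
  rewrite (integralB_EFin mB (ih x r) icst).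
  rewrite /average meanE// fineM// mulrBl mulrAC mulVf ?gt_eqF// mul1r.
  rewrite EFinB fineK//; congr (_ - _)%E.
  rewrite EFinM fineK ?measure_ball_fin//.
  exact: (integral_cst (measure_of mu) mB c%:E).
have mh : measurable_fun (ball x r : set (muType mu)) (fun y => (h y - c)%:E).
  exact: measurable_int (integrable_dist x r c ih).
have := le_abse_integral (measure_of mu) mB mh.
by rewrite E abse_EFin normrM [X in _ * X]gtr0_norm.
Qed.

(** Only [average h y s - average h x r], an average over the small ball of
    the deviation on the large ball, has to be estimated; passing to the large
    ball costs the ratio [D] of the two measures. *)
Lemma average_comparison h x y r s (b D : R) : 0 < r -> 0 < s ->
  locally_integrable h -> ball y s `<=` ball x r ->
  fine (mu (ball x r)) <= D * fine (mu (ball y s)) -> 0 <= b ->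
  (mean mu (ball x r) (fun z => `|h z - average h x r|%:E) <= b%:E)%E ->
  `|average h y s - average h x r| <= D * b.
Proof.
move=> r0 s0 ih sub hD b0; rewrite meanE// => osc.
have mr := fine_measure_ball_gt0 mms x r0.
have ms := fine_measure_ball_gt0 mms y s0.
rewrite -(ler_pM2r ms) -lee_fin.
apply: le_trans (average_dist_le y (average h x r) s0 ih) _.
apply: (@le_trans _ _ (\int[measure_of mu]_(z in ball x r) `|h z - average h x r|%:E)%E).
  apply: ge0_subset_integral => //; try exact: caratheodory_ball.
  have /integrable_norm := integrable_dist x r (average h x r) ih.
  exact: measurable_int.
apply: (@le_trans _ _ (fine (mu (ball x r)) * b)%:E).
  by rewrite EFinM -lee_pdivrMl.
by rewrite lee_fin mulrAC ler_wpM2r.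
Qed.

End averages.

(** * Hoelder continuity from decay of mean oscillations *)

(** The sequences [a i - c t^i] and [a i + c t^i] are monotone and enclose
    the limit, which gives the rate of convergence at once. *)
Lemma geometric_increments_limit {R : realType} (a : nat -> R) (c t : R) :
  0 <= c -> 0 <= t ->
  (forall i, `|a i.+1 - a i| <= c * (1 - t) * t ^+ i) ->
  exists L : R, forall i, `|L - a i| <= c * t ^+ i.
Proof.
move=> c0 t0 ha.
pose lo i := a i - c * t ^+ i; pose hi i := a i + c * t ^+ i.
have step i : lo i <= lo i.+1 /\ hi i.+1 <= hi i.
  have := ha i; rewrite ler_distl => /andP[h1 h2].
  by rewrite /lo /hi exprS; split; lra.
have lo_nd : {homo lo : i j / (i <= j)%N >-> i <= j}.
  by apply/nondecreasing_seqP => i; exact: (step i).1.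
have hi_ni : {homo hi : i j / (i <= j)%N >-> j <= i}.
  by apply/nonincreasing_seqP => i; exact: (step i).2.
have ct i : 0 <= c * t ^+ i by rewrite mulr_ge0// exprn_ge0.
have lohi i j : lo i <= hi j.
  apply: (@le_trans _ _ (lo (maxn i j))); first exact/lo_nd/leq_maxl.
  apply: (@le_trans _ _ (hi (maxn i j))); last exact/hi_ni/leq_maxr.
  by rewrite /lo /hi; have := ct (maxn i j); lra.
have ub : has_ubound (range lo) by exists (hi 0%N) => _ [i _ <-].
exists (sup (range lo)) => i; rewrite ler_distl; apply/andP; split.
  by apply: ub_le_sup => //; exists i.
apply: ge_sup; first by exists (lo 0%N); exists 0%N.
by move=> _ [j _ <-]; exact: lohi.
Qed.

Section geometric_decay.
Context {R : realType}.
Variable t : R.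
Hypotheses (t0 : 0 <= t) (t1 : t < 1).

Lemma le0_of_geometric (x A : R) : (forall i, x <= A * t ^+ i) -> x <= 0.
Proof.
move=> h; have tt : `|t| < 1 by rewrite ger0_norm.
have c := @cvg_geometric R A t tt.
have <- : limn (geometric A t) = 0 by apply/cvg_lim.
apply: limr_ge; first by apply/cvg_ex; exists 0.
by apply: nearW => i; exact: h.
Qed.

Lemma geometric_small (A e : R) : 0 < e -> exists i, A * t ^+ i <= e.
Proof.
move=> e0; apply: contrapT => h; have : e <= 0.
  apply: (@le0_of_geometric _ A) => i; rewrite leNgt; apply/negP => hi.
  by apply: h; exists i; exact: ltW.
by rewrite leNgt e0.
Qed.

End geometric_decay.

Lemma outer_measure_bigsetU_seq {R : realType} {T : Type} {I : eqType}
    (mu : {outer_measure set T -> \bar R}) (s : seq I) (F : I -> set T) :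
  (mu (\big[setU/set0]_(i <- s) F i) <= \sum_(i <- s) mu (F i))%E.
Proof.
elim: s => [|i s IH]; first by rewrite !big_nil outer_measure0.
rewrite !big_cons; apply: le_trans (outer_measureU2 _ _ _) _.
by rewrite leeD2l.
Qed.

Section campanato.
Context {R : realType} {X : pmetricType R}.
Variable mu : {outer_measure set X -> \bar R}.
Hypothesis mms : metric_measure_axioms mu.
Variable D : R.
Hypothesis D0 : 0 < D.
Hypothesis dbl : forall (x : X) (r : R), 0 < r ->
  (mu (ball x (2 * r)) <= D%:E * mu (ball x r))%E.
Variable alpha : R.
Hypothesis alpha0 : 0 < alpha.
Implicit Types (x y z : X) (r s : R) (h f : X -> R).

(** The radii for which the lower bound on the measure of balls is assumed. *)
Definition small_radius r := 0 < r /\ (r%:E < 2%:E * diam [set: X])%E.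

Definition oscillation_bound h (N : R) := forall x r, small_radius r ->
  (mean mu (ball x r) (fun y => `|h y - average mu h x r|%:E) <=
   (N * r `^ alpha)%:E)%E.

(** The factor by which [r^alpha] decreases when the radius is halved. *)
Definition dyadic_decay : R := 2^-1 `^ alpha.

Lemma dyadic_decay_ge0 : 0 <= dyadic_decay. Proof. exact: powR_ge0. Qed.

Lemma dyadic_decay_lt1 : dyadic_decay < 1.
Proof.
rewrite /dyadic_decay -[ltRHS](_ : 1 `^ alpha = 1); last by rewrite powR1.
by apply: gt0_ltr_powR; rewrite ?nnegrE//; lra.
Qed.

Lemma powR_dyadic r i : 0 <= r -> (r * 2^-1 ^+ i) `^ alpha = r `^ alpha * dyadic_decay ^+ i.
Proof.
move=> r0; rewrite powRM ?exprn_ge0 ?invr_ge0//; congr (_ * _).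
elim: i => [|i IH]; first by rewrite !expr0 powR1.
by rewrite !exprS powRM ?invr_ge0 ?exprn_ge0 ?invr_ge0// IH.
Qed.

Lemma small_radius_dyadic r i : small_radius r -> small_radius (r * 2^-1 ^+ i).
Proof.
move=> [r0 rd]; split; first by rewrite mulr_gt0// exprn_gt0.
apply: le_lt_trans rd; rewrite lee_fin; apply: ler_piMr; first exact: ltW.
by apply: exprn_ile1; lra.
Qed.

(** The sum of the geometric series of the changes between the averages over
    successive concentric balls, each change costing one doubling factor. *)
Definition campanato_const : R := D / (1 - dyadic_decay).

Lemma campanato_const_ge0 : 0 <= campanato_const.
Proof. by apply: divr_ge0; [exact: ltW|rewrite subr_ge0 ltW// dyadic_decay_lt1]. Qed.

Section oscillating_function.
Variables (h : X -> R) (N : R).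
Hypotheses (N0 : 0 <= N) (ih : locally_integrable mu h).
Hypothesis osc : oscillation_bound h N.
Notation avg := (average mu h).

Lemma average_nested x y r s k : small_radius r -> 0 < s ->
  ball y s `<=` ball x r -> ball x r `<=` ball y (2 ^+ k * s) ->
  `|avg y s - avg x r| <= D ^+ k * (N * r `^ alpha).
Proof.
move=> sr s0 sub sub2; case: (sr) => r0 _.
apply: (average_comparison mms r0 s0 ih sub); last exact: osc.
  exact: le_trans (le_measure_ball mms sub2) (doubling_iter mms _ _ s0 D0 dbl).
by rewrite mulr_ge0 ?powR_ge0.
Qed.

Lemma averages_limit x r : small_radius r -> exists L : R, forall i,
  `|L - avg x (r * 2^-1 ^+ i)| <= campanato_const * N * r `^ alpha * dyadic_decay ^+ i.
Proof.
move=> sr; apply: geometric_increments_limit => [| |i].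
- by rewrite mulr_ge0 ?powR_ge0// mulr_ge0// campanato_const_ge0.
- exact: dyadic_decay_ge0.
have sri := small_radius_dyadic i sr; have [ri0 _] := sri.
have E : r * 2^-1 ^+ i = 2 * (r * 2^-1 ^+ i.+1).
  by rewrite exprS; field.
have r10 : 0 < r * 2^-1 ^+ i.+1 by have [] := small_radius_dyadic i.+1 sr.
have := @average_nested x x _ _ 1 sri r10 _ _.
rewrite !expr1 -E powR_dyadic; last by case: sr => /ltW.
have -> : campanato_const * N * r `^ alpha * (1 - dyadic_decay) * dyadic_decay ^+ i =
    D * (N * (r `^ alpha * dyadic_decay ^+ i)).
  rewrite /campanato_const; field.
  by rewrite gt_eqF// subr_gt0 dyadic_decay_lt1.
apply => //; apply: subset_ball; rewrite mdistxx add0r E.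
by apply: ler_peMl; [exact: ltW|lra].
Qed.

(** The limit depends on the point only and not on the initial radius: at
    each step the two balls are comparable with a fixed doubling factor, so the
    difference of their averages tends to zero with their radii. *)
Lemma averages_limit_unique x r s L L' : small_radius r -> small_radius s ->
  (forall i, `|L - avg x (r * 2^-1 ^+ i)| <=
     campanato_const * N * r `^ alpha * dyadic_decay ^+ i) ->
  (forall i, `|L' - avg x (s * 2^-1 ^+ i)| <=
     campanato_const * N * s `^ alpha * dyadic_decay ^+ i) ->
  L = L'.
Proof.
wlog sler : r s L L' / s <= r.
  move=> wlg sr ss hr hs; have [/wlg|/ltW/wlg] := leP s r; first exact.
  by move=> w; apply/esym; exact: w hs hr.
move=> sr ss hr hs; have [r0 _] := sr; have [s0 _] := ss.
(* the number of doublings that separates the two scales *)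
have [k rks] : exists k, r <= 2 ^+ k * s.
  exists (Num.truncn (r / s)).+1; rewrite -ler_pdivrMr//.
  apply: (le_trans (ltW (truncnS_gt _))).
  by rewrite -natrX ler_nat ltnW// ltn_expl.
apply/eqP; rewrite -subr_eq0 -normr_le0.
apply: (@le0_of_geometric _ dyadic_decay dyadic_decay_ge0 dyadic_decay_lt1 _
  (campanato_const * N * r `^ alpha + D ^+ k * N * r `^ alpha +
   campanato_const * N * s `^ alpha)) => i.
have := hr i; have := hs i.
have ri := small_radius_dyadic i sr; have [si0 _] := small_radius_dyadic i ss.
have p0 : 0 <= 2^-1 ^+ i :> R by rewrite exprn_ge0.
have sub1 : ball x (s * 2^-1 ^+ i) `<=` ball x (r * 2^-1 ^+ i).
  by apply: subset_ball; rewrite mdistxx add0r ler_wpM2r.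
have sub2 : ball x (r * 2^-1 ^+ i) `<=` ball x (2 ^+ k * (s * 2^-1 ^+ i)).
  by apply: subset_ball; rewrite mdistxx add0r mulrA ler_wpM2r.
have h1 := average_nested ri si0 sub1 sub2.
rewrite powR_dyadic ?(ltW r0)// !mulrA in h1.
move=> h2 h3.
rewrite (_ : L - L' = (L - avg x (r * 2^-1 ^+ i)) -
  (avg x (s * 2^-1 ^+ i) - avg x (r * 2^-1 ^+ i)) -
  (L' - avg x (s * 2^-1 ^+ i))); last by ring.
apply: le_trans (ler_normB _ _) _; rewrite mulrDl lerD//.
by apply: le_trans (ler_normB _ _) _; rewrite mulrDl lerD.
Qed.

Lemma averages_representative : (exists r, small_radius r) ->
  exists f : X -> R, forall x r, small_radius r ->
    `|f x - avg x r| <= campanato_const * N * r `^ alpha.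
Proof.
move=> [r0 sr0].
have /choice[f fP] := fun x => averages_limit x sr0.
exists f => x r sr; have [L LP] := averages_limit x sr.
rewrite (averages_limit_unique sr0 sr (fP x) LP).
by have := LP 0%N; rewrite !expr0 !mulr1.
Qed.

(** The exponent 3 counts the doublings that take the ball around [y] in the
    comparison of the averages at [x] and [y] to one that contains the ball
    around [x]. *)
Definition hoelder_const : R := (2 * campanato_const + D ^+ 3) * (3 / 2) `^ alpha.

Lemma hoelder_const_ge0 : 0 <= hoelder_const.
Proof.
apply: mulr_ge0; last exact: powR_ge0.
by apply: addr_ge0; [rewrite mulr_ge0// campanato_const_ge0|rewrite exprn_ge0// ltW].
Qed.

Lemma small_radius_mdist x y : x != y -> small_radius (3 / 2 * mdist x y).
Proof.
rewrite -mdist_gt0 => d0; split; first by rewrite mulr_gt0//; lra.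
have := mdist_le_diam x y; case: (diam [set: X]) => [e|_|//].
  by rewrite -EFinM lee_fin lte_fin; lra.
by rewrite gt0_muley// ltry.
Qed.

Lemma small_radiusW r s : 0 < s -> s <= r -> small_radius r -> small_radius s.
Proof.
by move=> s0 sr [r0 rd]; split => //; apply: le_lt_trans rd; rewrite lee_fin.
Qed.

Section representative.
Variable f : X -> R.
Hypothesis fP : forall x r, small_radius r ->
  `|f x - avg x r| <= campanato_const * N * r `^ alpha.

(** The averages at [x] and [y] are compared on the balls of radii [3 d / 2]
    and [d / 2], where [d] is their distance.  The second ball lies in the
    first, and [3 d / 2] stays below twice the diameter of the space, which
    [2 d] might not. *)
Lemma representative_hoelder x y :
  `|f x - f y| <= hoelder_const * N * mdist x y `^ alpha.
Proof.
have [->|xy] := eqVneq x y.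
  rewrite subrr normr0 mulr_ge0 ?powR_ge0// mulr_ge0//.
  exact: hoelder_const_ge0.
have sr := small_radius_mdist xy.
have d0 : 0 < mdist x y by rewrite mdist_gt0.
set d := mdist x y in sr d0 *.
have s0 : 0 < d / 2 by rewrite divr_gt0.
have ss : small_radius (d / 2) by apply: small_radiusW sr => //; lra.
have sub1 : ball y (d / 2) `<=` ball x (3 / 2 * d).
  by apply: subset_ball; rewrite -/d; lra.
have sub2 : ball x (3 / 2 * d) `<=` ball y (2 ^+ 3 * (d / 2)).
  by apply: subset_ball; rewrite metric_sym -/d !exprS expr0; lra.
have h1 := average_nested sr s0 sub1 sub2.
have h2 := fP x sr.
have h3 := fP y ss.
have le_pow : (d / 2) `^ alpha <= (3 / 2 * d) `^ alpha.
  apply: ge0_ler_powR; rewrite ?nnegrE ?(ltW alpha0) ?(ltW s0) ?(ltW sr.1)//.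
  by rewrite mulrC ler_pM2r//; lra.
have KN : 0 <= campanato_const * N by rewrite mulr_ge0// campanato_const_ge0.
rewrite /hoelder_const -mulrA [N * _]mulrC mulrA -[_ * _ * d `^ _]mulrA.
have <- : (3 / 2 * d) `^ alpha = (3 / 2) `^ alpha * d `^ alpha.
  by rewrite powRM//; lra.
rewrite (_ : f x - f y = (f x - avg x (3 / 2 * d)) -
  (avg y (d / 2) - avg x (3 / 2 * d)) - (f y - avg y (d / 2))); last by ring.
apply: le_trans (ler_normB _ _) _.
rewrite (_ : _ * N = campanato_const * N * (3 / 2 * d) `^ alpha +
  D ^+ 3 * (N * (3 / 2 * d) `^ alpha) +
  campanato_const * N * (3 / 2 * d) `^ alpha); last by ring.
apply: lerD; last exact: le_trans h3 (ler_wpM2l KN le_pow).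
by apply: le_trans (ler_normB _ _) _; exact: lerD.
Qed.

(** Chebyshev's inequality for the deviation from the average: on a ball so
    small that [f] stays within [e] of this average, a deviation of [2 e] from
    [f] forces a deviation of [e] from the average. *)
Lemma representative_deviation_ball x r (e : R) : small_radius r -> 0 < e ->
  (campanato_const + hoelder_const) * N * r `^ alpha <= e ->
  (mu ([set y | (2 * e < `|h y - f y|)%R] `&` ball x r) <=
   (e^-1 * N * r `^ alpha * fine (mu (ball x r)))%:E)%E.
Proof.
move=> sr e0 hr; have [r0 _] := sr.
have c0 := campanato_const_ge0; have H0 := hoelder_const_ge0.
have ra0 : 0 <= r `^ alpha by rewrite powR_ge0.
have mB := caratheodory_ball mms x r.
have idist := integrable_dist mms x r (avg x r) ih.
have m0 := fine_measure_ball_gt0 mms x r0.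
apply: (@le_trans _ _ (mu (ball x r `&` [set y | (e%:E <= `|(h y - avg x r)%:E|)%E]))).
  apply: le_outer_measure => y [/= dev yB]; split => //=; rewrite lee_fin.
  have xy : mdist x y <= r by move: yB; rewrite ballEmdist => /ltW.
  have fxy : `|f x - f y| <= hoelder_const * N * r `^ alpha.
    apply: le_trans (representative_hoelder x y) _.
    apply: ler_wpM2l; first exact: mulr_ge0.
    by apply: ge0_ler_powR; rewrite ?nnegrE ?mdist_ge0 ?(ltW alpha0) ?(ltW r0).
  have := fP x sr.
  have : `|h y - f y| <= `|h y - avg x r| + `|f x - avg x r| + `|f x - f y|.
    rewrite (_ : h y - f y = (h y - avg x r) - (f x - avg x r) + (f x - f y)); last by ring.
    apply: le_trans (ler_normD _ _) _; rewrite lerD2r; exact: ler_normB.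
  by move: hr; rewrite mulrDl mulrDl; lra.
have := le_integral_abse (measure_of mu) mB (measurable_int _ idist) e0.
have := osc x sr; rewrite meanE// => h1.
have := h1; rewrite lee_pdivrMl// => h2 /le_trans/(_ h2).
rewrite -lee_pdivlMl// -EFinM => /le_trans; apply.
rewrite lee_fin !mulrA.
by rewrite [leLHS](_ : _ = e^-1 * N * r `^ alpha * fine (mu (ball x r)))//; ring.
Qed.

(** Sum the estimate over a maximal r-separated set.  Doubling turns the
    balls of radius [r] into disjoint balls of radius [r / 2], whose total
    measure is bounded independently of [r], and the remaining factor
    [r^alpha] tends to zero. *)
Lemma representative_deviation_null (x0 : X) (r0 e : R) :
  (forall r, small_radius r -> exists2 c, 0 < c & forall x, c <= fine (mu (ball x r))) ->
  (exists r, small_radius r) -> 0 < e ->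
  mu ([set y | (2 * e < `|h y - f y|)%R] `&` ball x0 r0) = 0%E.
Proof.
move=> low [r1 sr1] e0.
have [i0 hi0] := geometric_small dyadic_decay_ge0 dyadic_decay_lt1
  ((campanato_const + hoelder_const) * N * r1 `^ alpha) e0.
have sr2 := small_radius_dyadic i0 sr1.
set r2 := r1 * 2^-1 ^+ i0 in sr2.
have hr2 : (campanato_const + hoelder_const) * N * r2 `^ alpha <= e.
  by rewrite powR_dyadic ?mulrA//; case: sr1 => /ltW.
have [r20 _] := sr2.
set E := _ `&` _.
pose A := e^-1 * N * D * fine (mu (ball x0 (r0 + r2))) * r2 `^ alpha.
have key i : (mu E <= (A * dyadic_decay ^+ i)%:E)%E.
  have sr := small_radius_dyadic i sr2.
  have dy := powR_dyadic i (ltW r20).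
  have rle : r2 * 2^-1 ^+ i <= r2.
    by apply: ler_piMr; [exact: ltW|apply: exprn_ile1; lra].
  set r := r2 * 2^-1 ^+ i in sr dy rle.
  have [r_gt0 _] := sr.
  have srh : small_radius (r / 2) by apply: small_radiusW sr; lra.
  have [c c_gt0 hc] := low _ srh.
  have [s [cov sum_s]] := separated_covering mms x0 r0 r_gt0 c_gt0 hc.
  apply: (@le_trans _ _ (mu (\big[setU/set0]_(x <- s)
    ([set y | (2 * e < `|h y - f y|)%R] `&` ball x r)))).
    apply: le_outer_measure => y [dev /cov]; rewrite -!bigcup_seq => -[x xs xy].
    by exists x.
  apply: le_trans (outer_measure_bigsetU_seq _ _ _) _.
  apply: (@le_trans _ _ (\sum_(x <- s)
    (e^-1 * N * r `^ alpha * D * fine (mu (ball x (r / 2))))%:E)%E).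
    apply: lee_sum => x _.
    apply: le_trans (representative_deviation_ball x sr e0 _) _.
      apply: le_trans hr2; apply: ler_wpM2l.
        by rewrite mulr_ge0// addr_ge0 ?campanato_const_ge0 ?hoelder_const_ge0.
      by apply: ge0_ler_powR; rewrite ?nnegrE ?(ltW alpha0) ?(ltW r_gt0) ?(ltW r20).
    have h2 := dbl x (divr_gt0 r_gt0 (ltr0n R 2)).
    rewrite lee_fin -[leRHS]mulrA; apply: ler_wpM2l.
      by rewrite !mulr_ge0 ?invr_ge0 ?powR_ge0// ltW.
    move: h2; rewrite (_ : 2 * (r / 2) = r); last by field.
    rewrite -(fineK (measure_ball_fin mms x r)) -(fineK (measure_ball_fin mms x (r / 2))).
    by rewrite -EFinM lee_fin.
  rewrite sumEFin -mulr_sumr lee_fin.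
  apply: (@le_trans _ _ (e^-1 * N * r `^ alpha * D * fine (mu (ball x0 (r0 + r2))))).
    apply: ler_wpM2l.
      by rewrite !mulr_ge0 ?invr_ge0 ?powR_ge0// ltW.
    apply: le_trans sum_s _; apply: (le_measure_ball mms); apply: subset_ball.
    by rewrite mdistxx add0r lerD2l.
  rewrite dy /A [leLHS](_ : _ = e^-1 * N * D * fine (mu (ball x0 (r0 + r2))) *
    r2 `^ alpha * dyadic_decay ^+ i)//; ring.
have Efin : mu E \is a fin_num.
  by rewrite ge0_fin_numE ?outer_measure_ge0// (le_lt_trans (key 0%N))// ltry.
apply/eqP; rewrite eq_le outer_measure_ge0 andbT -(fineK Efin) lee_fin.
apply: (le0_of_geometric dyadic_decay_ge0 dyadic_decay_lt1 (A := A)) => i.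
by rewrite -lee_fin fineK.
Qed.

Lemma representative_ae :
  (forall r, small_radius r -> exists2 c, 0 < c & forall x, c <= fine (mu (ball x r))) ->
  (exists r, small_radius r) -> mu [set y | h y <> f y] = 0%E.
Proof.
move=> low ex; apply: (null_of_balls mms (x := point)) => r0 r00.
apply: negligible_null.
have null_union : (measure_of mu).-negligible
    (\bigcup_n ([set y | (2 * n.+1%:R^-1 < `|h y - f y|)%R] `&` ball (point : X) r0)).
  apply: negligible_bigcup => n; apply: (null_negligible mms).
  by apply: representative_deviation_null.
apply: negligibleS null_union.
move=> y [/= hf yB].
have d0 : 0 < `|h y - f y| by rewrite normr_gt0 subr_eq0; apply/eqP.
exists (Num.truncn (2 / `|h y - f y|)) => //; split => //=.
rewrite ltr_pdivrMr ?ltr0n// mulrC -ltr_pdivrMr//.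
exact: truncnS_gt.
Qed.

End representative.
End oscillating_function.
End campanato.

(** * Oscillation bound from the Poincare inequality *)

Section oscillation.
Context {R : realType} {X : pmetricType R}.
Variable mu : {outer_measure set X -> \bar R}.
Hypothesis mms : metric_measure_axioms mu.
Variables p q Q : R.
Hypotheses (p_ge1 : 1 <= p) (le_pq : p <= q).
Implicit Types (x y z : X) (r s M : R) (h f : X -> R).

Let p_gt0 : 0 < p. Proof. exact: lt_le_trans p_ge1. Qed.
Let q_gt0 : 0 < q. Proof. exact: lt_le_trans le_pq. Qed.

Lemma mulr_powRD1 (t a : R) : 0 < t -> t * t `^ a = t `^ (1 + a).
Proof.
move=> t0; rewrite powRD; last by rewrite (gt_eqF t0) implybT.
by rewrite powRr1 // ltW.
Qed.

Lemma le_1D_powR (t : R) : 0 <= t -> t <= 1 + t `^ p.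
Proof.
move=> t0; have [t1|/ltW t1] := leP t 1.
  by apply: le_trans t1 _; rewrite lerDl powR_ge0.
by apply: le_trans (le1r_powR t1 p_ge1) _; rewrite lerDr.
Qed.

Lemma morrey_locally_integrable h :
  measurable_fun [set: muType mu] (h : muType mu -> R) ->
  (morrey_norm mu p q (EFin \o h) < +oo)%E -> locally_integrable mu h.
Proof.
move=> mh hfin x r; have [r0|r0] := leP r 0.
  rewrite (_ : ball x r = set0); first exact: integrable_set0.
  rewrite -subset0 => y; rewrite ballEmdist /= => xy.
  by have := le_lt_trans (mdist_ge0 x y) xy; rewrite ltNge r0.
have nfin : morrey_norm mu p q (EFin \o h) \is a fin_num.
  by rewrite ge0_fin_numE ?morrey_norm_ge0.
have n0 : 0 <= fine (morrey_norm mu p q (EFin \o h)) by rewrite fine_ge0 ?morrey_norm_ge0.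
have /(morrey_normP mms q p_gt0 _ n0) bh :
  (morrey_norm mu p q (EFin \o h) <= (fine (morrey_norm mu p q (EFin \o h)))%:E)%E.
  by rewrite fineK.
have mB := caratheodory_ball mms x r.
have mhE : measurable_fun [set: muType mu] (EFin \o h) by exact/measurable_EFinP.
apply/integrableP; split; first exact: measurable_funTS.
apply: (@le_lt_trans _ _ (\int[measure_of mu]_(y in ball x r)
    (cst 1 y + `|(EFin \o h) y| `^ p))%E).
  apply: ge0_le_integral => //.
  - by apply: measurable_funTS; exact: measurableT_comp.
  - apply: emeasurable_funD; first exact: measurable_cst.
    exact: measurable_norm_power.
  - by move=> y _ /=; rewrite lee_fin le_1D_powR.
rewrite ge0_integralD//; last 2 first.
- by move=> y _; exact: poweR_ge0.
- exact: measurable_norm_power.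
apply: lte_add_pinfty.
  rewrite (integral_cst (measure_of mu) mB 1%E) mul1e.
  exact: measure_ball_lty.
by apply: le_lt_trans (bh x r r0) _; rewrite ltry.
Qed.

(** Since [tau >= 1], the measure of the dilated ball is bounded below by that
    of the original one; the lower bound on measures is thus used only for the
    small radius [r], although [tau r] may be large. *)
Lemma poincare_oscillation C tau CL h (G : X -> \bar R) M :
  0 < C -> 1 <= tau -> 0 < CL -> 0 <= M ->
  (forall (x : X) (r : R) (f : X -> R) (rho : X -> \bar R), 0 < r ->
      upper_gradient_on mu (ball x (tau * r)) f rho ->
      (measure_of mu).-integrable (ball x r : set (muType mu)) (EFin \o f) ->
      let fB := fine (mean mu (ball x r) (EFin \o f)) in
      (mean mu (ball x r) (fun y => `|f y - fB|%:E) <=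
       C%:E * diam (ball x r) *
       (mean mu (ball x (tau * r)) (fun y => rho y `^ p)) `^ p^-1)%E) ->
  (forall (x : X) (r : R), 0 < r -> (r%:E < 2%:E * diam [set: X])%E ->
        ((CL * r `^ Q)%:E <= mu (ball x r))%E) ->
  measurable_fun [set: muType mu] (h : muType mu -> R) -> locally_integrable mu h ->
  measurable_fun setT (G : borelType X -> \bar R) -> (forall x, 0 <= G x)%E ->
  morrey_bound mu p q G M ->
  (forall c : curve X, ~ constant_curve c -> upper_gradient_along h G c) ->
  oscillation_bound mu (1 - Q / q) h (2 * C * CL `^ (- q^-1) * M).
Proof.
move=> C0 tau1 CL0 M0 poincare lower mh ih mG G0 bG ugG x r [r0 rd].
have taur0 : 0 < tau * r by rewrite mulr_gt0// (lt_le_trans _ tau1).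
have ug : upper_gradient_on mu (ball x (tau * r)) h G.
  split=> [||y _|c nc _]; [exact: measurable_funTS|exact: measurable_funTS| |].
    exact: G0.
  exact: ugG.
apply: le_trans (poincare x r h G r0 ug (ih x r)) _.
have m0 := fine_measure_ball_gt0 mms x taur0.
set m := fine (mu (ball x (tau * r))) in m0.
pose T := M * m `^ (- q^-1).
have T0 : 0 <= T by rewrite mulr_ge0 ?powR_ge0.
have meanT : (mean mu (ball x (tau * r)) (fun y => G y `^ p) <= (T `^ p)%:E)%E.
  rewrite meanE// -/m lee_pdivrMl//.
  have := bG x _ taur0; under eq_integral do rewrite gee0_abs//.
  move=> /le_trans; apply; rewrite -EFinM lee_fin /T powRM ?powR_ge0//.
  rewrite mulrCA ler_wpM2l ?powR_ge0// -powRrM mulr_powRD1//.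
  by rewrite mulNr [q^-1 * p]mulrC.
have p1 : 0 <= p^-1 by rewrite invr_ge0 ltW.
have mean0 : (0 <= mean mu (ball x (tau * r)) (fun y => G y `^ p))%E.
  rewrite meanE// mule_ge0 ?lee_fin ?invr_ge0 ?(ltW m0)//.
  by apply: integral_ge0 => y _; exact: poweR_ge0.
have rootT : ((mean mu (ball x (tau * r)) (fun y => G y `^ p)) `^ p^-1 <= T%:E)%E.
  have := gt0_ler_poweR p1 _ _ meanT.
  rewrite !in_itv /= !leey !andbT mean0 lee_fin powR_ge0 => /(_ isT isT).
  by rewrite -powRrM mulfV ?gt_eqF// powRr1.
have rQ0 : 0 < CL * r `^ Q by rewrite mulr_gt0 ?powR_gt0.
have low_m : CL * r `^ Q <= m.
  have sub : ball x r `<=` ball x (tau * r).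
    by apply: subset_ball; rewrite mdistxx add0r ler_peMl// ltW.
  apply: le_trans (le_measure_ball mms sub).
  by rewrite -lee_fin fineK ?measure_ball_fin// lower.
have mq : m `^ (- q^-1) <= CL `^ (- q^-1) * r `^ (- (Q / q)).
  rewrite -mulrN powRrM -powRM ?powR_ge0 ?(ltW CL0)// !powRN.
  rewrite lef_pV2 ?posrE ?powR_gt0//.
  by apply: ge0_ler_powR; rewrite ?nnegrE ?invr_ge0 ?(ltW q_gt0) ?(ltW rQ0) ?(ltW m0).
have diam0 : (0 <= diam (ball x r))%E.
  apply: ereal_sup_ubound; exists (x, x); first by split; exact: ballxx.
  by rewrite mdistxx.
apply: (@le_trans _ _ (C%:E * (2 * r)%:E * T%:E)%E).
  apply: lee_pmul => //.
  - by rewrite mule_ge0// lee_fin ltW.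
  - exact: poweR_ge0.
  - by apply: lee_wpmul2l; [rewrite lee_fin ltW|exact: diam_ball_le].
rewrite -!EFinM lee_fin.
rewrite -mulr_powRD1//.
rewrite /T (_ : 2 * C * CL `^ (- q^-1) * M * (r * r `^ (- (Q / q))) =
  C * (2 * r) * (M * (CL `^ (- q^-1) * r `^ (- (Q / q))))); last by ring.
apply: ler_wpM2l; first by rewrite !mulr_ge0// ltW.
exact: ler_wpM2l.
Qed.

End oscillation.

(** * The embedding *)

Section hoelder_functions.
Context {R : realType} {X : pmetricType R}.
Variable mu : {outer_measure set X -> \bar R}.
Hypothesis mms : metric_measure_axioms mu.
Implicit Types (f : X -> R).

Lemma hoelder_continuous f (K alpha : R) : 0 < alpha -> 0 <= K ->
  (forall x y, `|f x - f y| <= K * mdist x y `^ alpha) -> continuous f.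
Proof.
move=> a0 K0 hf x; apply/cvg_ballP => e e0.
pose d := (e / (K + 1)) `^ alpha^-1.
have K1 : 0 < K + 1 by rewrite ltr_wpDl.
have eK : 0 < e / (K + 1) by rewrite divr_gt0.
have d0 : 0 < d by rewrite powR_gt0.
apply/nbhs_ballP; exists d => //= y; rewrite ballEmdist /= => xy.
rewrite /ball /=.
apply: le_lt_trans (hf x y) _.
have : mdist x y `^ alpha < e / (K + 1).
  rewrite -[ltRHS](_ : d `^ alpha = _); last first.
    by rewrite /d -powRrM mulVf ?gt_eqF// powRr1// ltW.
  by apply: gt0_ltr_powR; rewrite ?nnegrE ?mdist_ge0 ?(ltW d0).
rewrite ltr_pdivlMr// => h; apply: le_lt_trans h.
by rewrite mulrC ler_wpM2l ?powR_ge0// lerDl.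
Qed.

(** Nonempty open sets have positive measure. *)
Lemma continuous_ae_eq f f' : continuous f -> continuous f' ->
  mu [set x | f x <> f' x] = 0%E -> f = f'.
Proof.
move=> cf cf' null; apply/funext => x; apply: contrapT => ne.
have oU : open [set y | f y <> f' y].
  have -> : [set y | f y <> f' y] = (fun y => f y - f' y) @^-1` [set~ 0].
    apply/seteqP; split => y /=; first by move=> h /eqP; rewrite subr_eq0 => /eqP.
    by apply: contra_not => ->; rewrite subrr.
  apply: open_comp; last exact/closed_openC/closed_eq.
  by move=> y _; apply: cvgB; [exact: cf|exact: cf'].
case: mms => _ _ _ /(_ _ oU) pos.
have : (0 < mu [set y | f y <> f' y])%E by apply: pos; exists x.
by rewrite null ltxx.
Qed.

End hoelder_functions.

Theorem theorem3p1 (R : realType) (X : pmetricType R)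
    (mu : {outer_measure set X -> \bar R}) (p q Q : R)
    (p_ge1 : 1 <= p) (le_pq : p <= q) (Q_gt0 : 0 < Q) (lt_Qq : Q < q)
    (mu_mms : metric_measure_axioms mu)
    (mu_doubling : doubling mu)
    (mu_poincare : weak_poincare mu p)
    (mu_lower : exists2 C : R, 0 < C &
      forall (x : X) (r : R), 0 < r -> (r%:E < 2%:E * diam [set: X])%E ->
        ((C * r `^ Q)%:E <= mu (ball x r))%E) :
  exists2 C' : R, 0 < C' &
    forall F : set (X -> R), NM mu p q F ->
      exists2 f : X -> R, F f &
        forall x y : X,
          (`|f x - f y|%:E <=
           C'%:E * NMnorm mu p q F * (mdist x y `^ (1 - Q / q))%:E)%E.
Proof.
have p_gt0 : 0 < p by exact: lt_le_trans p_ge1.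
have q_gt0 : 0 < q by exact: lt_le_trans le_pq.
set alpha := 1 - Q / q.
have alpha0 : 0 < alpha by rewrite subr_gt0 ltr_pdivrMr// mul1r.
have [D D0 dbl] := mu_doubling.
have [C [tau [C0 tau1 poincare]]] := mu_poincare.
have [CL CL0 lower] := mu_lower.
pose K1 := 2 * C * CL `^ (- q^-1).
have K10 : 0 < K1 by rewrite !mulr_gt0 ?powR_gt0.
pose H := hoelder_const D alpha.
have H0 : 0 < H.
  apply: mulr_gt0; last by rewrite powR_gt0//; lra.
  apply: ltr_wpDl; last exact: exprn_gt0.
  by rewrite mulr_ge0// campanato_const_ge0.
exists (H * K1); first exact: mulr_gt0.
move=> _ [f0 Nf0 <-].
(* On a one-point space no radius satisfies the assumption on the lower
   bound, but every function is constant. *)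
have [xy|allxx] := pselect (exists x y : X, x != y); last first.
  have eqX (x y : X) : x = y.
    by apply: contrapT => ne; apply: allxx; exists x, y; apply/eqP.
  exists f0.
    apply: continuous_representative => //.
      have -> : f0 = cst (f0 (point : X)) by apply/funext => x; congr f0; exact: eqX.
      by move=> x; exact: cvg_cst.
    rewrite (_ : [set x | f0 x <> f0 x] = set0) ?outer_measure0//.
    by rewrite -subset0 => x /=; exact.
  move=> x y; rewrite (eqX x y) subrr normr0 mdistxx powR0 ?mule0//.
  by rewrite gt_eqF.
have ex_small : exists r, small_radius (X := X) r.
  have [x [y ne]] := xy; exists (3 / 2 * mdist x y).
  exact: small_radius_mdist.
have low r : small_radius (X := X) r ->
    exists2 c, 0 < c & forall x : X, c <= fine (mu (ball x r)).
  move=> [r0 rd]; exists (CL * r `^ Q); first by rewrite mulr_gt0 ?powR_gt0.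
  by move=> x; rewrite -lee_fin fineK ?measure_ball_fin// lower.
have representative h g M : NMtilde mu p q h -> weak_upper_gradient mu p q h g ->
    (morrey_norm mu p q g < M%:E)%E ->
    exists2 f : X -> R, mu [set x | h x <> f x] = 0%E &
      forall x y, `|f x - f y| <= H * (K1 * M) * mdist x y `^ alpha.
  move=> [mh /prenorm_lty[hfin _]] wg gM.
  have M0 : 0 <= M.
    by rewrite -lee_fin (le_trans (morrey_norm_ge0 mu p q g))// ltW.
  have [G [mG G0 bG ugG]] := genuine_upper_gradient mu_mms p_gt0 wg gM.
  have ih := morrey_locally_integrable mu_mms p_ge1 mh hfin.
  have osc := poincare_oscillation mu_mms p_ge1 le_pq C0 tau1 CL0 M0 poincare
    lower mh ih mG G0 bG ugG.
  have N0 : 0 <= K1 * M by rewrite mulr_ge0// ltW.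
  have [f fP] := averages_representative mu_mms D0 dbl alpha0 N0 ih osc ex_small.
  exists f; first exact: (representative_ae mu_mms D0 dbl alpha0 N0 ih osc fP).
  exact: (representative_hoelder mu_mms D0 dbl alpha0 N0 ih osc fP).
have hoelder_cont (f : X -> R) (M : R) : 0 <= M ->
    (forall x y : X, `|f x - f y| <= H * (K1 * M) * mdist x y `^ alpha) -> continuous f.
  move=> M0 hfM; have KM0 := mulr_ge0 (ltW H0) (mulr_ge0 (ltW K10) M0).
  exact: (hoelder_continuous alpha0 KM0 hfM).
have grad_fin g : (morrey_norm mu p q g < +oo)%E -> morrey_norm mu p q g \is a fin_num.
  by move=> h; rewrite ge0_fin_numE ?morrey_norm_ge0.
have fine_grad0 g : 0 <= fine (morrey_norm mu p q g).
  by rewrite fine_ge0 ?morrey_norm_ge0.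
have [_ [g0 wg0 g0fin]] := prenorm_lty Nf0.2.
have [f null hf] := representative f0 g0 (fine (morrey_norm mu p q g0) + 1) Nf0 wg0
  ltac:(by rewrite -[ltLHS](fineK (grad_fin _ g0fin)) lte_fin ltrDl).
have cf : continuous f by apply: hoelder_cont hf; rewrite addr_ge0.
exists f; first exact: continuous_representative.
move=> x y; have [->|ne] := eqVneq x y.
  by rewrite subrr normr0 mdistxx powR0 ?mule0// gt_eqF.
have d0 : 0 < mdist x y `^ alpha by rewrite powR_gt0// mdist_gt0.
pose c := H * K1 * mdist x y `^ alpha.
have c0 : 0 < c := mulr_gt0 (mulr_gt0 H0 K10) d0.
rewrite muleAC -EFinM -/c -lee_pdivrMl//.
apply: le_ereal_inf_tmp => _ [h Fh <-].
apply: le_trans (leeDr _ (morrey_norm_ge0 _ _ _ _)).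
apply: le_ereal_inf_tmp => _ [g wg <-].
have [gfin|] := ltP (morrey_norm mu p q g) +oo%E; last first.
  by rewrite leye_eq => /eqP ->; rewrite leey.
apply/lee_addgt0Pr => e e0; rewrite -(fineK (grad_fin _ gfin)) -EFinD.
set M := _ + e.
have [f' null' hf'] := representative h g M Fh.1 wg
  ltac:(by rewrite -[ltLHS](fineK (grad_fin _ gfin)) lte_fin /M ltrDl).
have cf' : continuous f' by apply: hoelder_cont hf'; rewrite addr_ge0// ltW.
(* both functions equal [h] almost everywhere: one through [f0], the other
   directly *)
have -> : f = f'.
  apply: (continuous_ae_eq mu_mms cf cf').
  have nullh := NMclass_ae mu_mms p_gt0 Nf0 Fh.
  apply: negligible_null.
  have null_union : (measure_of mu).-negligible
      ([set x | f0 x <> f x] `|` ([set x | h x <> f' x] `|` [set x | h x <> f0 x])).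
    by do 2?apply: negligibleU; exact: null_negligible.
  apply: negligibleS null_union => z /= ne'; apply: contrapT.
  move=> /not_orP[/contrapT e1 /not_orP[/contrapT e2 /contrapT e3]].
  by apply: ne'; rewrite -e1 -e2 e3.
rewrite -EFinM lee_fin mulrC ler_pdivrMr//.
apply: le_trans (hf' x y) _.
by rewrite /c [leLHS](_ : _ = M * (H * K1 * mdist x y `^ alpha))//; ring.
Qed.
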